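(* Let $d\ge1$ and $0\le k\le d$, and assume $[d]!\ne0$. Let $W=\mathbb V^{\otimes d}\otimes_{\mathscr H_d}\mathscr H_{d+k}\subset\widetilde T_d(\mathbb V)$, with $\mathscr H_{d+k}$ acting on $W$ by right multiplication (identified with its image in $\mathrm{End}_{\mathbb C(q)}(W)$). Let $\mathcal A_d^k\subset\mathrm{End}_{\mathbb C(q)}(W)$ be the $\mathbb C(q)$-span of all operators $L(w_d)\cdots L(w_1)L(\sigma)L(v_1^\ast)\cdots L(v_d^\ast)$ (restricted to $W$) with $w_1,\dots,w_d\in\mathbb V$, $\sigma\in\mathscr H_{d+k}$, $v_1^\ast,\dots,v_d^\ast\in\mathbb V^\ast$. Then $$\mathcal A_d^k=\mathrm{End}_{\mathscr H_{d+k}}(W)\qquad\text{and}\qquad\mathrm{End}_{\mathcal A_d^k}(W)=\mathscr H_{d+k}.$$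
   Context: $q$ is an indeterminate, $m,n\ge1$, $[m+n]=\{1,\dots,m+n\}$; $[a]=\frac{q^a-q^{-a}}{q-q^{-1}}$, $[d]!=[1]\cdots[d]$. The Hecke algebra $\mathscr H_d$ is the $\mathbb C(q)$-algebra generated by $T_1,\dots,T_{d-1}$ with relations $(T_i-q)(T_i+q^{-1})=0$, $T_iT_{i+1}T_i=T_{i+1}T_iT_{i+1}$, $T_iT_j=T_jT_i$ ($|i-j|>1$); $T_w=T_{i_1}\cdots T_{i_k}$ for a reduced expression $w=s_{i_1}\cdots s_{i_k}\in\mathfrak S_d$; $\mathscr H_\infty$ is the inductive limit of $\mathscr H_0\subset\mathscr H_1\subset\cdots$, and $T\mapsto T^{\uparrow k}$ is the algebra endomorphism with $T_i^{\uparrow k}=T_{i+k}$. Parity: $\hat i=0$ if $i\le m$, $\hat i=1$ if $i>m$; $q_i=q^{(-1)^{\hat i}}$. $\gamma(i,j)=1$ if $i>j$ and $-1$ if $i\le j$. $\mathbb V$ is the $\mathbb C(q)$-vector space with basis $e_1,\dots,e_{m+n}$, $e_i$ of parity $\hat i$; $e_1^\ast,\dots,e_{m+n}^\ast$ is the dual basis. For $I=(i_d,\dots,i_1)\in[m+n]^d$, $e_I=e_{i_d}\otimes\cdots\otimes e_{i_1}$, written $e_{i_d}\cdots e_{i_1}$; $I.s_k$ is $I$ with the entries $i_k,i_{k+1}$ swapped. The right $\mathscr H_d$-action on $\mathbb V^{\otimes d}$: $e_I.T_k=(-1)^{\hat i_k\hat i_{k+1}}e_{I.s_k}$ if $i_k>i_{k+1}$;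 $=(-1)^{\hat i_k}q_{i_k}e_I$ if $i_k=i_{k+1}$; $=(-1)^{\hat i_k\hat i_{k+1}}e_{I.s_k}+(q-q^{-1})e_I$ if $i_k<i_{k+1}$. Set $\widetilde T_d(\mathbb V)=\mathbb V^{\otimes d}\otimes_{\mathscr H_d}\mathscr H_\infty$, $\widetilde T(\mathbb V)=\bigoplus_{d\ge0}\widetilde T_d(\mathbb V)$, with product $(e_{j_k}\cdots e_{j_1}\otimes T_\tau)\cdot(e_{i_d}\cdots e_{i_1}\otimes T_\sigma)=e_{j_k}\cdots e_{j_1}e_{i_d}\cdots e_{i_1}\otimes T_\tau^{\uparrow d}T_\sigma$. For $\varphi\in\widetilde T(\mathbb V)$, $L(\varphi)$ is left multiplication by $\varphi$; $L(v)$ for $v\in\mathbb V$ uses $v\otimes1\in\widetilde T_1(\mathbb V)$ and $L(\sigma)$ for $\sigma\in\mathscr H_\infty$ uses $1\otimes\sigma\in\widetilde T_0(\mathbb V)$. For $j\in[m+n]$, $f_j(e_r)=q_j^{-\delta_{jr}}e_r$ and $g_j(e_r)=e_r\otimes T_1^{-\gamma(j,r)}\in\widetilde T_1(\mathbb V)$, and $L(e_j^\ast)=0$ on $\widetilde T_0(\mathbb V)$, $$L(e_j^\ast)(e_{i_d}\cdots e_{i_1}\otimes T_\sigma)=\sum_{k=1}^d(-1)^{\hat j(\hat i_d+\cdots+\hat i_{k+1})}\langle e_j^\ast,e_{i_k}\rangle\,g_j(e_{i_d})\cdots g_j(e_{i_{k+1}})f_j(e_{i_{k-1}})\cdots f_j(e_{i_1})\cdot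 T_\sigma$$ (product in $\widetilde T(\mathbb V)$); $L(v^\ast)$ is extended linearly in $v^\ast\in\mathbb V^\ast$. For a subset $A\subset\mathrm{End}_{\mathbb C(q)}(W)$, $\mathrm{End}_A(W)$ denotes its commutant. *)

(* Defs.v *)
From HB Require Import structures.
From mathcomp Require Import all_boot all_algebra all_field.
From mathcomp Require Import complex Rstruct.
Set Implicit Arguments. Unset Strict Implicit. Unset Printing Implicit Defensive.
Import GRing.Theory.
Local Open Scope ring_scope.

Notation CC := (complex Rdefinitions.R).
Notation Fq := {fraction {poly CC}}.
Definition qq : Fq := FracField.tofrac ('X : {poly CC}).

Definition qint (a : nat) : Fq := (qq ^+ a - qq ^- a) / (qq - qq^-1).
Definition qfact (d : nat) : Fq := \prod_(1 <= a < d.+1) qint a.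

Definition hecke_rel (A : algType Fq) (D : nat) (t : nat -> A) : Prop :=
  [/\ forall i, (0 < i < D)%N -> (t i - qq%:A) * (t i + (qq^-1)%:A) = 0,
      forall i, (0 < i)%N -> (i.+1 < D)%N -> t i * t i.+1 * t i = t i.+1 * t i * t i.+1
    & forall i j, (0 < i < D)%N -> (0 < j < D)%N -> ((i.+1 < j) || (j.+1 < i))%N ->
        t i * t j = t j * t i].

(* (H, T) is a presentation of H_D by generators and relations:
   the relations hold, the T_i generate H as a unital algebra, and
   (universal property) any family satisfying the relations in any
   F-algebra B is the image of T under an algebra morphism H -> B. *)
Definition hecke_presentation (D : nat) (H : falgType Fq) (T : nat -> H) : Prop :=
  [/\ hecke_rel D T,
      (forall U : {vspace H}, 1 \in U ->
         (forall i u, (0 < i < D)%N -> u \in U -> T i * u \in U) -> U = fullv)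
    & (forall (B : algType Fq) (t : nat -> B), hecke_rel D t ->
        exists phi : H -> B,
          [/\ forall a x y, phi (a *: x + y) = a *: phi x + phi y,
              forall x y, phi (x * y) = phi x * phi y,
              phi 1 = 1
            & forall i, (0 < i < D)%N -> phi (T i) = t i])].

Definition sgn (b : bool) : Fq := if b then -1 else 1.

Notation MI m n r := {ffun 'I_r -> 'I_(m + n)}.
Notation MT m n H r := {ffun {ffun 'I_r -> 'I_(m + n)} -> H}.

Section Tensor.
Variables (m n : nat) (H : falgType Fq) (T : nat -> H).

(* indices 1..m+n are represented 0-based by 'I_(m+n) *)
Local Notation idx := 'I_(m + n).
(* parity: \hat i = 1 iff i > m (1-based), i.e. i >= m 0-based *)
Definition parity (a : idx) : bool := (m <= a)%N.
Definition qof (a : idx) : Fq := if parity a then qq^-1 else qq.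

(* multi-index I = (i_r,...,i_1) of length r : position p (0-based)
   holds i_{p+1} *)
Local Notation mi r := (MI m n r).

(* V^{(x) r} (x)_C(q) H : the element x stands for sum_I e_I (x) x I *)
Local Notation Mt r := (MT m n H r).

Definition tens r (J : mi r) (h : H) : Mt r :=
  [ffun J' => if J' == J then h else 0].

(* I.s_k with k = p+1 : swap entries at 0-based positions p and p+1 *)
Definition swapmi r (p : nat) (I : mi r) : mi r :=
  [ffun t : 'I_r => if val t == p then nth (I t) (codom I) p.+1
                    else if val t == p.+1 then nth (I t) (codom I) p
                    else I t].

(* coefficient of e_J in e_I . T_k, for k = p+1 (so i_k = I p) *)
Definition tcoef r (p : 'I_r) (I J : mi r) : Fq :=
  let a := I p in
  let b := nth a (codom I) p.+1 in
  let Is := swapmi p I in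
  let s := sgn (parity a && parity b) in
  if (b < a)%N then (J == Is)%:R * s
  else if a == b then (J == I)%:R * (sgn (parity a) * qof a)
  else (J == Is)%:R * s + (J == I)%:R * (qq - qq^-1).

(* generator of the relations of (x)_{H_r}: (e_I.T_k) (x) h - e_I (x) T_k h *)
Definition relgen r (p : 'I_r) (I : mi r) (h : H) : Mt r :=
  \sum_(J : mi r) tcoef p I J *: tens J h - tens I (T p.+1 * h).

(* the subspace by which one quotients to get V^{(x) r} (x)_{H_r} H *)
Definition Rel (r : nat) : {vspace Mt r} :=
  <<flatten [seq [seq relgen p Ii h | Ii <- enum (mi r), h <- vbasis {: H}]
             | p <- [seq p : 'I_r <- enum 'I_r | (p.+1 < r)%N]]>>%VS.

(* L(e_a) : degree r -> degree r+1 ;  e_I (x) h |-> e_a e_I (x) h *)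
Definition Lup r (a : idx) (x : Mt r) : Mt r.+1 :=
  [ffun J : mi r.+1 => if J ord_max == a
       then x [ffun t : 'I_r => J (widen_ord (leqnSn r) t)] else 0].

Definition Lupv r (v : {ffun idx -> Fq}) (x : Mt r) : Mt r.+1 :=
  \sum_(a : idx) v a *: Lup a x.

Definition rmv r (I : mi r.+1) (p : 'I_r.+1) : mi r :=
  [ffun t : 'I_r => I (lift p t)].

(* Hecke part of g_j(e_{i_d})...g_j(e_{i_{k+1}}) f_j(e_{i_{k-1}})...f_j(e_{i_1})
   in the product of ~T(V) (d = r+1, k = p+1):
   T_{d-1}^{eps_d} ... T_k^{eps_{k+1}}, eps_s = - gamma(j, i_s). *)
Definition gprod r (I : mi r.+1) (j : idx) (p : 'I_r.+1) : H :=
  \prod_(t <- rev (enum 'I_r.+1) | (p < t)%N)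
     (if (I t < j)%N then (T t)^-1 else T t).

Definition Ldown r (j : idx) (x : Mt r.+1) : Mt r :=
  \sum_(I : mi r.+1) \sum_(p : 'I_r.+1 | I p == j)
     (sgn (parity j && odd #|[set t : 'I_r.+1 | (p < t)%N && parity (I t)]|)
      * \prod_(t : 'I_r.+1 | (t < p)%N) (if I t == j then (qof j)^-1 else 1))
     *: tens (rmv I p) (gprod I j p * x I).

Definition Ldownv r (v : {ffun idx -> Fq}) (x : Mt r.+1) : Mt r :=
  \sum_(j : idx) v j *: Ldown j x.

Definition Lsig (s : H) (x : Mt 0) : Mt 0 := [ffun I => s * x I].

Definition rho r (s : H) (x : Mt r) : Mt r := [ffun I => x I * s].

(* L(v_1^* ) ... L(v_r^* ) : degree r -> degree 0 (v_{i+1}^* = vs i) *)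
Fixpoint downs (r : nat) (vs : nat -> {ffun idx -> Fq}) : Mt r -> Mt 0 :=
  match r with
  | 0 => fun x => x
  | r'.+1 => fun x => downs vs (Ldownv (vs r') x)
  end.

(* L(w_r) ... L(w_1) : degree 0 -> degree r (w_{i+1} = ws i) *)
Fixpoint ups (r : nat) (ws : nat -> {ffun idx -> Fq}) : Mt 0 -> Mt r :=
  match r with
  | 0 => fun y => y
  | r'.+1 => fun y => Lupv (ws r') (ups r' ws y)
  end.

Definition Aop d (ws : nat -> {ffun idx -> Fq}) (s : H)
    (vs : nat -> {ffun idx -> Fq}) (x : Mt d) : Mt d :=
  ups d ws (Lsig s (downs vs x)).

Definition inA d (f : Mt d -> Mt d) : Prop :=
  exists (l : nat) (c : 'I_l -> Fq) (ws vs : 'I_l -> nat -> {ffun idx -> Fq})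
         (s : 'I_l -> H),
    forall x, f x = \sum_(i < l) c i *: Aop (ws i) (s i) (vs i) x.

End Tensor.

(* Operators on the quotient W = M / R, encoded by representatives. *)
Definition lin_op (V : lmodType Fq) (f : V -> V) : Prop :=
  forall a x y, f (a *: x + y) = a *: f x + f y.
Definition descends (V : vectType Fq) (R : {vspace V}) (f : V -> V) : Prop :=
  forall x, x \in R -> f x \in R.
Definition eqW (V : vectType Fq) (R : {vspace V}) (f g : V -> V) : Prop :=
  forall x, f x - g x \in R.

(* Main.v *)
(* W is a quotient of a sum of copies of H = H_{d+k}, and the operators in A_d^k are the sums of
   composites W -> H -> W of an H-map L(sigma) L(v_1^* )...L(v_d^* ) with an H-map H -> W.
   By the relation L(e_j^* )(e_a x) = [a = j] f_j(x) +- e_a T_r^{+-1} L(e_j^* )(x), the operator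
   L(e_j)L(e_j^* ) acts on a vector of weight kappa as [kappa_j], so that
   L(e_{j_d})...L(e_{j_1})L(e_{j_1}^* )...L(e_{j_d}^* ) is a scalar on each weight space, nonzero
   exactly on the weight of (j_d,...,j_1) because [d]! <> 0.  Hence the identity of W is such a
   sum of composites, and f = f o id puts every H-endomorphism f of W into A_d^k.

   For the second equality, the pairs (T_w, T_{w^-1}), built from coset representatives of
   H_{n-1} in H_n, form a Casimir element.  Its value z = sum_w T_w T_{w^-1} is central and
   invertible: the T_w span a lattice over the local ring of C(q) at q = 1 on which z is congruent
   to (d+k)! modulo q = 1.  Averaging a linear retraction of h |-> (w_i h)_i, where the w_i span W,
   yields H-endomorphisms of W, and commuting with them forces f(w) z = w s for a fixed s. *)
Require Import Defs.
From HB Require Import structures.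
From mathcomp Require Import all_boot all_algebra all_field.
From mathcomp Require Import complex Rstruct.
From mathcomp Require Import ring zify.
Set Implicit Arguments. Unset Strict Implicit. Unset Printing Implicit Defensive.
Import GRing.Theory.
Local Open Scope ring_scope.

Local Notation xi := (qq - qq^-1).

(** * Linear maps and scalars *)

Section LinearMap.
Variables (F : fieldType) (V W : lmodType F) (f : V -> W).
Hypothesis fL : linear f.

Definition lin_map : {linear V -> W} := HB.pack f (GRing.isLinear.Build F V W _ f fL).

Lemma linear_at0 : f 0 = 0.
Proof. exact: (linear0 lin_map). Qed.

Lemma linear_atZ c x : f (c *: x) = c *: f x.
Proof. exact: (linearZ_LR lin_map). Qed.

Lemma linear_atB x y : f (x - y) = f x - f y.
Proof. exact: (linearB lin_map). Qed.

Lemma linear_at_sum (I : Type) (r : seq I) (P : pred I) (F' : I -> V) :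
  f (\sum_(i <- r | P i) F' i) = \sum_(i <- r | P i) f (F' i).
Proof. exact: (linear_sum lin_map). Qed.

End LinearMap.

Section LinearHom.
Variables (F : fieldType) (V W : vectType F) (f : V -> W).
Hypothesis fL : linear f.

Definition hom_of : 'Hom(V, W) := linfun (lin_map fL).

Lemma hom_ofE x : hom_of x = f x.
Proof. exact: (lfunE (lin_map fL)). Qed.

Lemma hom_of_section x : f (hom_of^-1%VF (f x)) = f x.
Proof. by rewrite -!hom_ofE limg_lfunVK // memv_img // memvf. Qed.

Lemma lker_hom_of x : (x \in lker hom_of) = (f x == 0).
Proof. by rewrite memv_ker hom_ofE. Qed.

Lemma preim_hom_of x U : (x \in hom_of @^-1: U)%VS = (f x \in U).
Proof. by rewrite -memv_preim hom_ofE. Qed.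

End LinearHom.

Section FieldIdentities.
Variable F : fieldType.

Lemma qint_step (q : F) (a : nat) : q != 0 -> q - q^-1 != 0 ->
  (q ^+ a.+1 - q ^- a.+1) / (q - q^-1) = q ^- a + q * ((q ^+ a - q ^- a) / (q - q^-1)).
Proof.
move=> q0; rewrite !exprS; have := expf_neq0 a q0; move: (q ^+ a) => Q Q0 x0.
rewrite invfM; apply: (mulIf x0); rewrite divfK // [RHS]mulrDl -[X in _ = _ + X]mulrA divfK //.
by field; apply/andP.
Qed.

Lemma qint_stepV (q : F) (a : nat) : q != 0 -> q - q^-1 != 0 ->
  (q ^+ a.+1 - q ^- a.+1) / (q - q^-1)
  = q^-1 ^- a + q^-1 * ((q ^+ a - q ^- a) / (q - q^-1)).
Proof.
move=> q0; rewrite exprVn invrK !exprS; have := expf_neq0 a q0; move: (q ^+ a) => Q Q0 x0.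
rewrite invfM; apply: (mulIf x0); rewrite divfK // [RHS]mulrDl -[X in _ = _ + X]mulrA divfK //.
by field; apply/andP.
Qed.

Lemma fracD_cross (x y s s' p p' : F) :
  x * s = p -> y * s' = p' -> (x + y) * (s * s') = p * s' + p' * s.
Proof. by move=> <- <-; ring. Qed.

End FieldIdentities.

(** * The parameter q, quantum integers, and evaluation at q = 1 *)

Lemma qq_neq0 : qq != 0.
Proof. by rewrite /qq tofrac_eq0 polyX_eq0. Qed.

Lemma xi_neq0 : xi != 0.
Proof.
apply/eqP => xi0.
have : qq * xi = 0 by rewrite xi0 mulr0.
rewrite mulrBr mulfV ?qq_neq0 // => h.
have : FracField.tofrac (('X : {poly CC}) ^+ 2 - 1) = 0.
  by rewrite rmorphB rmorphXn rmorph1 -[RHS]h expr2.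
move/eqP; rewrite tofrac_eq0 => /eqP /(congr1 (fun p : {poly CC} => p`_2)).
by rewrite coefB coefXn coef1 coef0 subr0 => /eqP; rewrite oner_eq0.
Qed.

Lemma qint0 : qint 0 = 0.
Proof. by rewrite /qint expr0 invr1 subrr mul0r. Qed.

Lemma qint1 : qint 1 = 1.
Proof. by rewrite /qint expr1; exact: mulfV xi_neq0. Qed.

Definition qsg (b : bool) : Fq := if b then qq^-1 else qq.

(** Quantum integers are invariant under exchanging q and its inverse, so the recursion has two
    forms; the parity of a letter j selects the one written in q_j. *)
Lemma qintS b a : qint a.+1 = qsg b ^- a + qsg b * qint a.
Proof.
case: b; first exact: (qint_stepV a qq_neq0 xi_neq0).
exact: (qint_step a qq_neq0 xi_neq0).
Qed.

Lemma qint_neq0 d a : qfact d != 0 -> (0 < a <= d)%N -> qint a != 0.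
Proof.
move=> hd /andP[a0 ad].
have /allP h : all (fun a => qint a != 0) (index_iota 1 d.+1).
  by rewrite -(prodf_seq_neq0 _ xpredT).
have ha : a \in index_iota 1 d.+1 by rewrite mem_index_iota a0 ltnS.
exact: (h a ha).
Qed.

(* x lies in the local ring of C(q) at q = 1 and takes the value a there. *)
Definition ev1 (x : Fq) (a : CC) : Prop :=
  exists p s : {poly CC}, [/\ s.[1] != 0, x * FracField.tofrac s = FracField.tofrac p
                            & p.[1] = a * s.[1]].

Lemma ev1_tofrac (p : {poly CC}) : ev1 (FracField.tofrac p) p.[1].
Proof. by exists p, 1; rewrite hornerC oner_neq0 rmorph1 !mulr1. Qed.

Lemma ev1D x y a b : ev1 x a -> ev1 y b -> ev1 (x + y) (a + b).
Proof.
move=> [p [s [s0 xs ps]]] [p' [s' [s0' xs' ps']]]; exists (p * s' + p' * s), (s * s').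
split; first by rewrite hornerM mulf_neq0.
  by rewrite rmorphD !rmorphM /=; exact: fracD_cross.
rewrite hornerD !hornerM; apply/esym.
exact: fracD_cross.
Qed.

Lemma ev1M x y a b : ev1 x a -> ev1 y b -> ev1 (x * y) (a * b).
Proof.
move=> [p [s [s0 xs ps]]] [p' [s' [s0' xs' ps']]]; exists (p * p'), (s * s').
split; first by rewrite hornerM mulf_neq0.
  by rewrite !rmorphM /= mulrACA xs xs'.
by rewrite !hornerM ps ps' mulrACA.
Qed.

Lemma ev1_0 : ev1 0 0.
Proof. by have := ev1_tofrac 0; rewrite rmorph0 horner0. Qed.

Lemma ev1_1 : ev1 1 1.
Proof. by have := ev1_tofrac 1; rewrite rmorph1 hornerC. Qed.

Lemma ev1_nat n : ev1 n%:R n%:R.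
Proof.
elim: n => [|n IHn]; first exact: ev1_0.
by rewrite -addn1 !natrD; apply: ev1D => //; apply: ev1_1.
Qed.

Lemma ev1_N1 : ev1 (-1) (-1).
Proof. by have := ev1_tofrac (-1); rewrite rmorphN rmorph1 hornerN hornerC. Qed.

Lemma ev1_sum (I : Type) (r : seq I) (f : I -> Fq) (g : I -> CC) :
  (forall i, ev1 (f i) (g i)) -> ev1 (\sum_(i <- r) f i) (\sum_(i <- r) g i).
Proof. by move=> h; elim/big_rec2: _ => [|i x y _]; [exact: ev1_0|apply: ev1D]. Qed.

Lemma ev1_prod (I : Type) (r : seq I) (f : I -> Fq) (g : I -> CC) :
  (forall i, ev1 (f i) (g i)) -> ev1 (\prod_(i <- r) f i) (\prod_(i <- r) g i).
Proof. by move=> h; elim/big_rec2: _ => [|i x y _]; [exact: ev1_1|apply: ev1M]. Qed.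

Lemma ev1_det N (A : 'M[Fq]_N) (B : 'M[CC]_N) :
  (forall i j, ev1 (A i j) (B i j)) -> ev1 (\det A) (\det B).
Proof.
move=> h; apply: ev1_sum => s; apply: ev1M; last exact: ev1_prod.
by case: (perm.odd_perm s); rewrite ?expr0 ?expr1; [exact: ev1_N1|exact: ev1_1].
Qed.

Lemma ev1_inj0 a : ev1 0 a -> a = 0.
Proof.
move=> [p [s [s0]]]; rewrite mul0r => /esym/eqP; rewrite tofrac_eq0 => /eqP->.
by rewrite horner0 => /esym/eqP; rewrite mulf_eq0 (negPf s0) orbF => /eqP.
Qed.

Lemma ev1_xi : ev1 xi 0.
Proof.
(* q - 1/q is the fraction (X^2 - 1)/X, whose numerator vanishes at 1. *)
exists ('X^2 - 1), 'X; rewrite hornerX oner_neq0 !hornerE; split => //.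
  by rewrite mulrBl mulVf ?qq_neq0 // rmorphB rmorphXn rmorph1.
by rewrite expr1n subrr.
Qed.

(** Evaluation at q = 1 commutes with determinants, so the determinant of C specializes to s^N,
    which is nonzero in characteristic 0. *)
Lemma det_scalar_add_small N (C : 'M[Fq]_N) (s : nat) :
  (0 < s)%N -> (forall i j, ev1 (C i j - s%:R * (i == j)%:R) 0) -> \det C != 0.
Proof.
move=> s0 hC; apply/eqP => d0.
have : ev1 (\det C) (\det ((s%:R)%:M : 'M[CC]_N)).
  apply: ev1_det => i j; rewrite mxE -[C i j](subrK (s%:R * (i == j)%:R)) -[X in ev1 _ X]add0r.
  by apply: ev1D => //; rewrite -[X in ev1 _ X]mulr_natr; apply: ev1M; apply: ev1_nat.
rewrite d0 det_scalar => /ev1_inj0 /eqP; rewrite expf_eq0 => /andP[_].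
by rewrite Num.Theory.pnatr_eq0 -leqn0 leqNgt s0.
Qed.

(** * The Casimir element of the Hecke algebra *)

Section HeckeGeneric.
Variables (F : fieldType) (A : algType F).

Lemma quadratic_rel (t : A) (q : F) : q != 0 ->
  (t - q%:A) * (t + (q^-1)%:A) = 0 -> t * t = 1 + (q - q^-1) *: t.
Proof.
move=> q0; rewrite mulrDr !mulrBl -!scalerAr -!scalerAl !mulr1 mul1r scalerA mulVf //.
rewrite scale1r scalerBl => h; apply/eqP; rewrite -subr_eq0 -h; apply/eqP.
by rewrite [1 + _]addrC !opprD !opprK !addrA.
Qed.

End HeckeGeneric.

Section Hecke.
Variables (H : falgType Fq) (T : nat -> H) (D : nat).
Hypothesis hT : hecke_rel D T.

Lemma heckeC i j : (0 < i < D)%N -> (0 < j < D)%N -> (i.+1 < j)%N || (j.+1 < i)%N ->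
  T i * T j = T j * T i.
Proof. by case: hT => _ _; apply. Qed.

Lemma hecke_braid i : (0 < i)%N -> (i.+1 < D)%N ->
  T i * T i.+1 * T i = T i.+1 * T i * T i.+1.
Proof. by case: hT => _ + _; apply. Qed.

Lemma hecke_sqr i : (0 < i < D)%N -> T i * T i = 1 + xi *: T i.
Proof. by case: hT => h _ _ /h; apply: quadratic_rel qq_neq0. Qed.

(* T_k T_{k+1} ... T_n and its reverse, for 1 <= k <= n+1: the minimal coset representatives of
   H_n in H_{n+1}. *)
Definition up k n : H := \prod_(k <= i < n.+1) T i.
Definition dn k n : H := \prod_(i <- rev (index_iota k n.+1)) T i.

Lemma up_cons k n : (k <= n)%N -> up k n = T k * up k.+1 n.
Proof. by move=> kn; rewrite /up big_ltn. Qed.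

Lemma dn_cons k n : (k <= n)%N -> dn k n = dn k.+1 n * T k.
Proof.
move=> kn; rewrite /dn /index_iota subSn // /= rev_cons -cats1 big_cat big_seq1.
by rewrite subSS.
Qed.

Lemma up_nil n : up n.+1 n = 1. Proof. by rewrite /up big_geq. Qed.

Lemma dn_nil n : dn n.+1 n = 1.
Proof. by rewrite /dn /index_iota subnn big_nil. Qed.

Lemma up_far i k n : (0 < i)%N -> (i.+1 < k)%N -> (n < D)%N -> T i * up k n = up k n * T i.
Proof.
move=> i0 ik nD; rewrite /up big_nat_cond; apply: commr_prod => j.
by rewrite andbT => /andP[kj jn]; apply: heckeC; lia.
Qed.

Lemma dn_far i k n : (0 < i)%N -> (i.+1 < k)%N -> (n < D)%N -> dn k n * T i = T i * dn k n.
Proof.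
move=> i0 ik nD; apply/esym; rewrite /dn big_seq; apply: commr_prod => j.
by rewrite mem_rev mem_index_iota => /andP[kj jn]; apply: heckeC; lia.
Qed.

(** [T j.+1] commutes past the factors before [T j], the braid relation turns it into [T j], and
    this commutes with the remaining factors. The induction is on j - k. *)
Lemma up_shift k j n : (0 < k)%N -> (k <= j)%N -> (j < n)%N -> (n < D)%N ->
  T j.+1 * up k n = up k n * T j.
Proof.
move=> k0 kj jn nD; have [m mE] : exists m, (m + k)%N = j by exists (j - k)%N; lia.
elim: m k k0 mE kj => [|m IHm] k k0 mE kj.
  rewrite add0n in mE; rewrite mE up_cons 1?up_cons; [|lia|lia].
  rewrite !mulrA -hecke_braid; [|lia|lia].
  by rewrite -!mulrA up_far ?mulrA //; lia.
rewrite up_cons; last by lia.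
rewrite mulrA heckeC; [|lia|lia|lia].
by rewrite -mulrA IHm ?mulrA //; lia.
Qed.

Lemma dn_shift k j n : (0 < k)%N -> (k <= j)%N -> (j < n)%N -> (n < D)%N ->
  dn k n * T j.+1 = T j * dn k n.
Proof.
move=> k0 kj jn nD; have [m mE] : exists m, (m + k)%N = j by exists (j - k)%N; lia.
elim: m k k0 mE kj => [|m IHm] k k0 mE kj.
  rewrite add0n in mE; rewrite mE dn_cons 1?dn_cons; [|lia|lia].
  rewrite -!mulrA [T j.+1 * (_ * _)]mulrA -hecke_braid; [|lia|lia].
  by rewrite !mulrA dn_far //; lia.
rewrite dn_cons; last by lia.
rewrite -mulrA heckeC; [|lia|lia|lia].
by rewrite !mulrA IHm //; lia.
Qed.

(* The pairs (T_w, T_{w^-1}) for w in S_{n+1}. *)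
Fixpoint cas (n : nat) : seq (H * H) :=
  if n is n'.+1 then
    [seq (up k n * g.1, g.2 * dn k n) | k <- index_iota 1 n.+2, g <- cas n']
  else [:: (1, 1)].

(** Identities in the tensor square of H are stated by applying an arbitrary bilinear map to both
    sides. *)
Definition bilin (X : lmodType Fq) (f : H -> H -> X) :=
  (forall y, linear (f^~ y)) /\ (forall x, linear (f x)).

Lemma big_casS (X : zmodType) n (f : H -> H -> X) :
  \sum_(g <- cas n.+1) f g.1 g.2 =
  \sum_(1 <= k < n.+3) \sum_(g <- cas n) f (up k n.+1 * g.1) (g.2 * dn k n.+1).
Proof.
by rewrite -[cas n.+1]/[seq (up k n.+1 * g.1, g.2 * dn k n.+1) | k <- index_iota 1 n.+3,
  g <- cas n] big_allpairs_dep.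
Qed.

(** Left multiplication by [T i] permutes the cosets of the smaller Hecke algebra: it exchanges
    those of index i and i+1 up to a term in [xi] common to both sides, and fixes every other one,
    where it becomes a generator of the smaller algebra and the induction hypothesis applies. *)
Lemma casimir n (X : lmodType Fq) (f : H -> H -> X) i : bilin f ->
  (n < D)%N -> (0 < i <= n)%N ->
  \sum_(g <- cas n) f (T i * g.1) g.2 = \sum_(g <- cas n) f g.1 (g.2 * T i).
Proof.
elim: n f i => [|n IHn] f i fL nD; first by case: i.
case/andP=> i0 iN.
rewrite (big_casS _ (fun x y => f (T i * x) y)) (big_casS _ (fun x y => f x (y * T i))).
have nD' := ltnW nD.
have far k : k != i -> k != i.+1 -> (0 < k < n.+3)%N ->
    \sum_(g <- cas n) f (T i * (up k n.+1 * g.1)) (g.2 * dn k n.+1) =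
    \sum_(g <- cas n) f (up k n.+1 * g.1) (g.2 * dn k n.+1 * T i).
  move=> ki kSi /andP[k0 kn].
  pose f' x y := f (up k n.+1 * x) (y * dn k n.+1).
  have f'L : bilin f'.
    case: fL => fl fr; split=> [y a x x'|x a y y']; rewrite /f'.
      by rewrite mulrDr -scalerAr fl.
    by rewrite mulrDl -scalerAl fr.
  (* If k < i, the generator crosses the coset representative with its index lowered by one; if k >
     i+1, it commutes with the representative. *)
  case: (ltngtP k i) => [lt|gt|E]; last by rewrite E eqxx in ki.
    case: i i0 iN ki kSi lt => // j _ jn _ _ kj.
    have j0 : (0 < j)%N by apply: leq_trans k0 _.
    transitivity (\sum_(g <- cas n) f' (T j * g.1) g.2).
      by apply: eq_bigr => g _; rewrite /f' !mulrA up_shift.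
    rewrite IHn // ?j0 //; apply: eq_bigr => g _.
    by rewrite /f' -!mulrA dn_shift.
  have ik : (i.+1 < k)%N by rewrite ltn_neqAle gt eq_sym kSi.
  have iN' : (i <= n)%N by rewrite -ltnS -ltnS (leq_trans ik).
  transitivity (\sum_(g <- cas n) f' (T i * g.1) g.2).
    by apply: eq_bigr => g _; rewrite /f' !mulrA up_far.
  rewrite IHn // ?i0 //; apply: eq_bigr => g _.
  by rewrite /f' -!mulrA dn_far.
(* The two cosets i and i+1 are isolated; all the others are handled by [far]. *)
rewrite !(@big_cat_nat _ _ _ i 1 n.+3) /=; [|lia|lia|lia|lia].
rewrite !(@big_ltn _ _ _ i); [|lia|lia].
rewrite !(@big_ltn _ _ _ i.+1); [|lia|lia].
congr (_ + _).
  by rewrite big_nat [RHS]big_nat; apply: eq_bigr => k kI; apply: far; lia.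
rewrite !addrA; congr (_ + _); last first.
  by rewrite big_nat [RHS]big_nat; apply: eq_bigr => k kI; apply: far; lia.
rewrite -!big_split /=; apply: eq_bigr => g _.
case: fL => fl fr.
(* By the quadratic relation, coset i goes to coset i+1 plus a multiple of itself; [e2] is the
   mirror image. *)
have e1 : T i * up i n.+1 = up i.+1 n.+1 + xi *: up i n.+1.
  by rewrite up_cons // mulrA hecke_sqr; [|lia]; rewrite mulrDl mul1r -scalerAl.
have e2 : dn i n.+1 * T i = dn i.+1 n.+1 + xi *: dn i n.+1.
  by rewrite dn_cons // -mulrA hecke_sqr; [|lia]; rewrite mulrDr mulr1 -scalerAr.
rewrite ![T i * (_ * _)]mulrA e1 -up_cons // -![_ * _ * T i]mulrA e2 -dn_cons //.
rewrite mulrDl mulrDr -scalerAl -scalerAr ![_ + xi *: _]addrC fl fr.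
by rewrite -!addrA; congr (_ + _); rewrite addrC.
Qed.

(** * Lattices over the local ring at q = 1, and invertibility of the Casimir value *)

Inductive lat (P : Fq -> Prop) (b : seq H) : H -> Prop :=
| lat0 : lat P b 0
| latZD c x v : x \in b -> P c -> lat P b v -> lat P b (c *: x + v).

Lemma latD P b u v : lat P b u -> lat P b v -> lat P b (u + v).
Proof.
move=> hu hv; elim: hu => [|c x w xb Pc _ IH]; first by rewrite add0r.
by rewrite -addrA; apply: latZD.
Qed.

Lemma latZ (P Q : Fq -> Prop) b a v :
  (forall c, P c -> Q (a * c)) -> lat P b v -> lat Q b (a *: v).
Proof.
move=> PQ; elim=> [|c x w xb Pc _ IH]; first by rewrite scaler0; apply: lat0.
by rewrite scalerDr scalerA; apply: latZD => //; apply: PQ.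
Qed.

Lemma lat_mull (P Q R : Fq -> Prop) b b' h v :
  (forall c e, P c -> Q e -> R (c * e)) -> (forall x, x \in b -> lat Q b' (h * x)) ->
  lat P b v -> lat R b' (h * v).
Proof.
move=> PQR hb; elim=> [|c x w xb Pc _ IH]; first by rewrite mulr0; apply: lat0.
rewrite mulrDr -scalerAr; apply: latD => //.
by apply: (latZ (P := Q)); [move=> e; apply: PQR|apply: hb].
Qed.

Lemma lat_coef (P : Fq -> Prop) b v : P 0 -> (forall c e, P c -> P e -> P (c + e)) ->
  lat P b v -> exists c : 'I_(size b) -> Fq, (forall i, P (c i)) /\ v = \sum_i c i *: b`_i.
Proof.
move=> P0 PD; elim=> [|c x w xb Pc _ [c' [Pc' ->]]].
  by exists (fun=> 0); split=> //; rewrite big1 // => i _; rewrite scale0r.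
(* The list b may have repetitions, so each member contributes to the coefficient at its first
   occurrence. *)
have xs : (index x b < size b)%N by rewrite index_mem.
pose j := Ordinal xs.
exists (fun i => (if i == j then c else 0) + c' i); split.
  by move=> i; apply: PD => //; case: ifP.
under [RHS]eq_bigr do rewrite scalerDl.
rewrite big_split /=; congr (_ + _).
rewrite (bigD1 j) //= eqxx nth_index // big1 ?addr0 // => i /negPf ->.
by rewrite scale0r.
Qed.

(** [reg1] is the local ring of C(q) at q = 1 and [van1] its maximal ideal; as coefficient
    conditions in [lat] they give a lattice and its multiple by the maximal ideal. *)
Definition reg1 (c : Fq) : Prop := exists a, ev1 c a.
Definition van1 (c : Fq) : Prop := ev1 c 0.

Lemma reg1M c e : reg1 c -> reg1 e -> reg1 (c * e).
Proof. by move=> [a ha] [a' ha']; exists (a * a'); apply: ev1M. Qed.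

Lemma reg1_van1 c e : reg1 c -> van1 e -> van1 (c * e).
Proof. by move=> [a ha] he; rewrite /van1 -(mulr0 a); apply: ev1M. Qed.

Lemma van1_reg1 c e : van1 c -> reg1 e -> van1 (c * e).
Proof. by move=> hc he; rewrite mulrC; apply: reg1_van1. Qed.

Lemma reg1_1 : reg1 1. Proof. by exists 1; apply: ev1_1. Qed.

Lemma lat_in b x : x \in b -> lat reg1 b x.
Proof.
by move=> xb; rewrite -[x]addr0 -[x]scale1r; apply: latZD => //; [apply: reg1_1|apply: lat0].
Qed.

Definition integral b h := forall x, x \in b -> lat reg1 b (h * x).
Definition small b h := forall x, x \in b -> lat van1 b (h * x).

Lemma smallD b h h' : small b h -> small b h' -> small b (h + h').
Proof. by move=> sh sh' x xb; rewrite mulrDl; apply: latD; [apply: sh|apply: sh']. Qed.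

Lemma small_mulr b h u : small b h -> integral b u -> small b (h * u).
Proof.
move=> sh iu x xb; rewrite -mulrA.
by apply: (lat_mull (P := reg1) (Q := van1) (b := b)) (iu x xb); [apply: reg1_van1|].
Qed.

Lemma small_mull b h u : small b h -> integral b u -> small b (u * h).
Proof.
move=> sh iu x xb; rewrite -mulrA.
by apply: (lat_mull (P := van1) (Q := reg1) (b := b)) (sh x xb); [apply: van1_reg1|].
Qed.

Lemma small_xi b h : integral b h -> small b (xi *: h).
Proof.
move=> ih x xb; rewrite -scalerAl; apply: latZ (ih x xb) => c hc.
by apply: van1_reg1 => //; apply: ev1_xi.
Qed.

Definition bs n := [seq g.1 | g <- cas n].

Lemma bsSP n x : x \in bs n.+1 ->
  exists k v, [/\ (0 < k < n.+3)%N, v \in bs n & x = up k n.+1 * v].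
Proof.
case/mapP=> p /allpairsP[[k g] [/= kI gI ->]] ->; exists k, g.1; split=> //.
  by rewrite mem_index_iota in kI.
by apply/mapP; exists g.
Qed.

Lemma bs_up n k v : (0 < k < n.+3)%N -> v \in bs n -> up k n.+1 * v \in bs n.+1.
Proof.
move=> kI /mapP[g gI ->]; apply/mapP; exists (up k n.+1 * g.1, g.2 * dn k n.+1) => //.
by apply/allpairsP; exists (k, g); split => //=; rewrite mem_index_iota.
Qed.

Lemma lat_up n k v : (0 < k < n.+3)%N -> lat reg1 (bs n) v ->
  lat reg1 (bs n.+1) (up k n.+1 * v).
Proof.
move=> kI; apply: (lat_mull (Q := reg1)); first exact: reg1M.
by move=> x xb; apply: lat_in; apply: bs_up.
Qed.

(** The same coset analysis as for the Casimir identity applies; the only new coefficient is [xi],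
    which is regular at q = 1. *)
Lemma bs_integral n i : (n < D)%N -> (0 < i <= n)%N -> integral (bs n) (T i).
Proof.
elim: n i => [|n IHn] i nD iN x; first by lia.
case/bsSP=> k [v [kI vb ->]]; rewrite mulrA.
have [lt|[gt|[E|E]]] : (k < i)%N \/ (i.+1 < k)%N \/ k = i \/ k = i.+1 by lia.
- case: i iN lt => [|j] iN lt; first by lia.
  rewrite up_shift -?mulrA; [|lia|lia|lia|lia].
  by apply: lat_up => //; apply: IHn => //; lia.
- rewrite up_far -?mulrA; [|lia|lia|lia].
  by apply: lat_up => //; apply: IHn => //; lia.
- rewrite E up_cons; last by lia.
  rewrite mulrA hecke_sqr; last by lia.
  rewrite mulrDl mul1r -scalerAl -up_cons; last by lia.
  rewrite mulrDl -scalerAl; apply: latD.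
    by apply: lat_in; apply: bs_up => //; lia.
  apply: (latZ (P := reg1)); first by move=> c; apply: reg1M; exists 0; apply: ev1_xi.
  by apply: lat_in; apply: bs_up => //; lia.
- rewrite E -up_cons; last by lia.
  by apply: lat_in; apply: bs_up => //; lia.
Qed.

Lemma bs1 n : 1 \in bs n.
Proof.
elim: n => [|n IHn]; first by rewrite mem_head.
by have := @bs_up n n.+2 1 (ltnSn _) IHn; rewrite up_nil mulr1.
Qed.

(** At q = 1 the generators become involutions, so T_w T_{w^-1} specializes to 1. The lattice of
    level N stays fixed while n varies in the induction. *)
Lemma small_cas N n g : (N < D)%N -> (n <= N)%N -> g \in cas n -> small (bs N) (g.1 * g.2 - 1).
Proof.
move=> ND; elim: n g => [|n IHn] g nN.
  rewrite inE => /eqP -> x _ /=; rewrite mulr1 subrr mul0r; exact: lat0.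
case/allpairsP=> [[k p] [/= kI pI ->]] /=; rewrite mem_index_iota in kI.
have {IHn} : small (bs N) (p.1 * p.2 - 1) by apply: IHn => //; lia.
rewrite -mulrA [p.1 * (_ * _)]mulrA; move: (p.1 * p.2) => y hy {p pI g}.
have [m mE] : exists m, (k + m)%N = n.+2 by exists (n.+2 - k)%N; lia.
elim: m k kI mE => [|m IHm] k kI mE.
  by rewrite addn0 in mE; rewrite mE up_nil dn_nil mul1r mulr1.
rewrite up_cons 1?dn_cons; [|lia|lia].
have iT : integral (bs N) (T k) by apply: bs_integral => //; lia.
(* Peeling the outer [T k] off both ends leaves [T k * T k - 1], which is [xi *: T k] and hence
   small. *)
have -> : T k * up k.+1 n.+1 * (y * (dn k.+1 n.+1 * T k)) - 1 =
   T k * (up k.+1 n.+1 * (y * dn k.+1 n.+1) - 1) * T k + xi *: T k.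
  rewrite mulrBr mulr1 mulrBl hecke_sqr; last by lia.
  by rewrite !mulrA opprD addrA subrK.
apply: smallD; last exact: small_xi.
apply: (small_mulr _ iT); apply: (small_mull _ iT); apply: IHm; lia.
Qed.

Definition casz n : H := \sum_(g <- cas n) g.1 * g.2.

Lemma small_casz n : (n < D)%N -> small (bs n) (casz n - (size (cas n))%:R).
Proof.
move=> nD; have -> : casz n - (size (cas n))%:R = \sum_(g <- cas n) (g.1 * g.2 - 1).
  by rewrite sumrB big_const_seq count_predT iter_addr_0.
rewrite big_seq; apply: (big_ind (small (bs n))).
- by move=> x _; rewrite mul0r; apply: lat0.
- exact: smallD.
- by move=> g gI; apply: small_cas gI.
Qed.

(** On the spanning list b, multiplication by [casz n] has a matrix congruent to s times the
    identity modulo q = 1, with s the number of pairs. Its determinant is nonzero, and since 1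
    belongs to b, Cramer's rule solves for an inverse. *)
Lemma casz_unit n : (n < D)%N -> exists c, casz n * c = 1.
Proof.
move=> nD; set b := bs n; set s := size (cas n).
have s0 : (0 < s)%N.
  by have := bs1 n; rewrite /bs /s; case: (cas n).
have hC (i : 'I_(size b)) : exists c : {ffun 'I_(size b) -> Fq},
    (forall j, ev1 (c j) 0) /\ (casz n - s%:R) * b`_i = \sum_j c j *: b`_j.
  have [|c e vc ve|c [hc e]] := lat_coef (P := van1) _ _ (small_casz nD (mem_nth 0 (ltn_ord i))).
  - exact: ev1_0.
  - by rewrite /van1 -[0]addr0; apply: ev1D.
  - exists (finfun c); split=> [j|]; first by rewrite ffunE; apply: hc.
    by apply: etrans e _; apply: eq_bigr => j _; rewrite ffunE.
have [c hc] : exists c : 'I_(size b) -> {ffun 'I_(size b) -> Fq}, forall i,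
    (forall j, ev1 (c i j) 0) /\ (casz n - s%:R) * b`_i = \sum_j c i j *: b`_j.
  by apply: (fin_all_exists hC).
pose C : 'M[Fq]_(size b) := \matrix_(i, j) (c i j + s%:R * (i == j)%:R).
have detC : \det C != 0.
  apply: (det_scalar_add_small s0) => i j; rewrite mxE addrK; exact: (hc i).1.
have hz (i : 'I_(size b)) : casz n * b`_i = \sum_j C i j *: b`_j.
  rewrite -[casz n](subrK s%:R) mulrDl (hc i).2.
  under [RHS]eq_bigr do rewrite mxE scalerDl.
  rewrite big_split /=; congr (_ + _).
  rewrite (bigD1 i) //= eqxx mulr1 big1 ?addr0 ?scaler_nat ?mulr_natl // => j /negPf.
  by rewrite eq_sym => ->; rewrite mulr0 scale0r.
have ib : (index (1 : H)%R b < size b)%N by rewrite index_mem bs1.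
pose i0 := Ordinal ib.
(* This is the row of the inverse matrix at the index of 1. *)
exists ((\det C)^-1 *: \sum_i (\adj C) i0 i *: b`_i).
rewrite -scalerAr mulr_sumr.
transitivity ((\det C)^-1 *: \sum_j ((\adj C *m C) i0 j *: b`_j)).
  congr (_ *: _).
  rewrite (eq_bigr (fun i => \sum_j ((\adj C) i0 i * C i j) *: b`_j)); last first.
    by move=> i _; rewrite -scalerAr hz scaler_sumr; apply: eq_bigr => j _; rewrite scalerA.
  rewrite exchange_big; apply: eq_bigr => j _.
  by rewrite mxE scaler_suml.
rewrite mul_adj_mx (bigD1 i0) //= big1 ?addr0; last first.
  by move=> j /negPf ji; rewrite mxE eq_sym ji mulr0n scale0r.
rewrite mxE eqxx mulr1n scalerA nth_index ?bs1 //.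
by rewrite (mulVf detC) scale1r.
Qed.

End Hecke.

(** * Creation and annihilation operators *)

Section Tensors.
Variables (m n : nat) (H : falgType Fq) (T : nat -> H).
Local Notation idx := 'I_(m + n).
Local Notation mi r := (MI m n r).
Local Notation Mt r := (MT m n H r).
Implicit Types (a b j : idx) (h : H).

Definition lmul r h (x : Mt r) : Mt r := [ffun I => h * x I].

Definition fsc j a : Fq := if a == j then (qof j)^-1 else 1.

(** This is f_j applied to every letter. *)
Definition fdiag r j (x : Mt r) : Mt r := [ffun I : mi r => (\prod_t fsc j (I t)) *: x I].

Lemma tens_linear r (J : mi r) : linear (@tens m n H r J).
Proof.
move=> c u v; apply/ffunP => I; rewrite !ffunE; case: eqP => // _.
by rewrite scaler0 addr0.
Qed.
HB.instance Definition _ r (J : mi r) :=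
  GRing.isLinear.Build Fq H (Mt r) _ (tens J) (tens_linear J).

Lemma Lup_linear r a : linear (@Lup m n H r a).
Proof.
move=> c u v; apply/ffunP => I; rewrite !ffunE; case: eqP => // _.
by rewrite scaler0 addr0.
Qed.
HB.instance Definition _ r a :=
  GRing.isLinear.Build Fq (Mt r) (Mt r.+1) _ (Lup a) (@Lup_linear r a).

Lemma lmul_linear r h : linear (@lmul r h).
Proof. by move=> c u v; apply/ffunP => I; rewrite !ffunE mulrDr scalerAr. Qed.
HB.instance Definition _ r h :=
  GRing.isLinear.Build Fq (Mt r) (Mt r) _ (lmul h) (@lmul_linear r h).

Lemma rho_linear r h : linear (@rho m n H r h).
Proof. by move=> c u v; apply/ffunP => I; rewrite !ffunE mulrDl scalerAl. Qed.
HB.instance Definition _ r h :=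
  GRing.isLinear.Build Fq (Mt r) (Mt r) _ (rho h) (@rho_linear r h).

Lemma fdiag_linear r j : linear (@fdiag r j).
Proof.
move=> c u v; apply/ffunP => I; rewrite !ffunE.
by rewrite scalerDr !scalerA [_ * c]mulrC.
Qed.
HB.instance Definition _ r j :=
  GRing.isLinear.Build Fq (Mt r) (Mt r) _ (fdiag j) (@fdiag_linear r j).

Lemma Ldown_linear r j : linear (@Ldown m n H T r j).
Proof.
move=> c u v; rewrite /Ldown scaler_sumr -big_split; apply: eq_bigr => I _ /=.
rewrite scaler_sumr -big_split; apply: eq_bigr => p _ /=.
rewrite !ffunE mulrDr linearD scalerDr -scalerAr linearZ /= !scalerA.
by rewrite [_ * c]mulrC.
Qed.
HB.instance Definition _ r j :=
  GRing.isLinear.Build Fq (Mt r.+1) (Mt r) _ (Ldown T j) (@Ldown_linear r j).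

Lemma tens_expand r (x : Mt r) : x = \sum_I tens I (x I).
Proof.
apply/ffunP => J; rewrite sum_ffunE (bigD1 J) //= ffunE eqxx big1 ?addr0 // => I.
by rewrite eq_sym ffunE => /negPf->.
Qed.

Lemma linear_ext_tens r (V : lmodType Fq) (f g : Mt r -> V) : linear f -> linear g ->
  (forall I h, f (tens I h) = g (tens I h)) -> f =1 g.
Proof.
move=> fL gL fg x; rewrite (tens_expand x) (linear_at_sum fL) (linear_at_sum gL).
by apply: eq_bigr => I _; exact: fg.
Qed.

(** Positions count from the right, so the new leftmost letter sits at [ord_max]. *)
Definition consI r a (I : mi r) : mi r.+1 :=
  [ffun t => if unlift ord_max t is Some t' then I t' else a].

Lemma consI_max r a (I : mi r) : consI a I ord_max = a.
Proof. by rewrite ffunE unlift_none. Qed.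

Lemma widen_lift r (t : 'I_r) : widen_ord (leqnSn r) t = lift ord_max t.
Proof. by apply: val_inj; rewrite /= /bump leqNgt ltn_ord. Qed.

Lemma consI_widen r a (I : mi r) t : consI a I (widen_ord (leqnSn r) t) = I t.
Proof. by rewrite widen_lift ffunE liftK. Qed.

Variant ord_top r : 'I_r.+1 -> Type :=
| OrdMax : ord_top ord_max
| OrdWiden t : ord_top (widen_ord (leqnSn r) t).

Lemma ord_topP r (t : 'I_r.+1) : ord_top t.
Proof.
case: (unliftP ord_max t) => [t'|] ->; last exact: OrdMax.
by rewrite -widen_lift; apply: OrdWiden.
Qed.

Lemma consIP r (J : mi r.+1) :
  J = consI (J ord_max) [ffun t : 'I_r => J (widen_ord (leqnSn r) t)].
Proof.
by apply/ffunP => t; case: (ord_topP t) => [|t']; rewrite ?consI_max // consI_widen ffunE.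
Qed.

Lemma consI_inj r a b (I J : mi r) : consI a I = consI b J -> a = b /\ I = J.
Proof.
move=> e; split; first by rewrite -(consI_max a I) e consI_max.
by apply/ffunP => t; rewrite -(consI_widen a I) e consI_widen.
Qed.

Lemma Lup_cons r a b (x : Mt r) (I : mi r) :
  Lup a x (consI b I) = if b == a then x I else 0.
Proof.
rewrite ffunE consI_max; congr (if _ then x _ else _).
by apply/ffunP => t; rewrite ffunE consI_widen.
Qed.

Lemma Lup_tens r a (I : mi r) h : Lup a (tens I h) = tens (consI a I) h.
Proof.
apply/ffunP => J; rewrite [J]consIP Lup_cons [RHS]ffunE [in LHS]ffunE.
set b := J _; set J' := [ffun _ => _].
case: (b =P a) => [->|ba]; last first.
  by case: eqP => // /consI_inj[].
by case: (J' =P I) => [->|JI]; rewrite ?eqxx //; case: eqP => // /consI_inj[].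
Qed.

Definition lcoef r j (I : mi r.+1) (p : 'I_r.+1) : Fq :=
  sgn (parity j && odd #|[set t : 'I_r.+1 | (p < t)%N && parity (I t)]|)
  * \prod_(t : 'I_r.+1 | (t < p)%N) (if I t == j then (qof j)^-1 else 1).

Lemma Ldown_tens r j (I : mi r.+1) h : Ldown T j (tens I h) =
  \sum_(p | I p == j) lcoef j I p *: tens (rmv I p) (gprod T I j p * h).
Proof.
rewrite /Ldown (bigD1 I) //= [X in _ + X]big1 ?addr0 => [|J /negPf JI].
  by apply: eq_bigr => p _; rewrite ffunE eqxx.
by rewrite big1 // => p _; rewrite ffunE JI mulr0 linear0 scaler0.
Qed.

(** The Hecke factor contributed by g_j(e_a), where r counts the letters that stood to the right of
    e_a before one of them was removed. *)
Definition geps a j r : H := if (a < j)%N then (T r)^-1 else T r.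

Lemma rmv_max r a (I : mi r) : rmv (consI a I) ord_max = I.
Proof. by apply/ffunP => t; rewrite ffunE -widen_lift consI_widen. Qed.

Lemma rmv_widen r a (I : mi r.+1) p :
  rmv (consI a I) (widen_ord (leqnSn r.+1) p) = consI a (rmv I p).
Proof.
apply/ffunP => t; rewrite ffunE; case: (ord_topP t) => [|t'].
  rewrite consI_max; have -> : lift (widen_ord (leqnSn r.+1) p) ord_max = ord_max.
    by apply: val_inj; rewrite /= /bump -ltnS ltn_ord.
  by rewrite consI_max.
rewrite consI_widen [in RHS]ffunE.
have -> : lift (widen_ord (leqnSn r.+1) p) (widen_ord (leqnSn r) t')
  = widen_ord (leqnSn r.+1) (lift p t') by apply: val_inj.
by rewrite consI_widen.
Qed.

Lemma gprod_max r a j (I : mi r) : gprod T (consI a I) j ord_max = 1.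
Proof. by rewrite /gprod big_pred0 // => t /=; rewrite ltnNge -ltnS ltn_ord. Qed.

Lemma gprod_widen r a j (I : mi r.+1) p :
  gprod T (consI a I) j (widen_ord (leqnSn r.+1) p) = geps a j r.+1 * gprod T I j p.
Proof.
rewrite /gprod enum_ordSr rev_rcons big_cons /= ltn_ord consI_max -/(geps a j r.+1).
congr (_ * _); rewrite -map_rev big_map; apply: eq_bigr => t _.
by rewrite consI_widen.
Qed.

Lemma lcoef_max r a j (I : mi r) : lcoef j (consI a I) ord_max = \prod_t fsc j (I t).
Proof.
rewrite /lcoef; have -> : [set t : 'I_r.+1 | (@ord_max r < t)%N && parity (consI a I t)] = set0.
  by apply/setP => t; rewrite !inE ltnNge -ltnS ltn_ord.
rewrite cards0 andbF mul1r big_mkcond big_ord_recr /= ltnn mulr1.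
by apply: eq_bigr => t _; rewrite /= ltn_ord consI_widen.
Qed.

Lemma sgnM x y : sgn (x (+) y) = sgn x * sgn y.
Proof. by case: x; case: y; rewrite /sgn ?mulr1 ?mul1r ?mulrNN ?mulr1. Qed.

Lemma lcoef_widen r a j (I : mi r.+1) p :
  lcoef j (consI a I) (widen_ord (leqnSn r.+1) p) = sgn (parity j && parity a) * lcoef j I p.
Proof.
rewrite /lcoef mulrA -sgnM; congr (sgn _ * _).
  rewrite -andb_addr; congr (_ && _).
  rewrite !cardsE -!sum1_card big_mkcond big_ord_recr /= [in RHS]big_mkcond /=.
  rewrite oddD addbC unfold_in /= ltn_ord consI_max; congr (_ (+) odd _); first by case: parity.
  by apply: eq_bigr => t _; rewrite !unfold_in /= consI_widen.
rewrite big_mkcond big_ord_recr /= ltnNge ltnW ?ltn_ord //= mulr1 [RHS]big_mkcond.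
by apply: eq_bigr => t _; rewrite /= consI_widen.
Qed.

Definition Llow j a r : Mt r -> Mt r :=
  if r is r'.+1 then fun x => Lup a (lmul (geps a j r'.+1) (Ldown T j x)) else fun=> 0.

Lemma Llow_linear j a r : linear (@Llow j a r).
Proof.
case: r => [|r] c u v /=; first by rewrite scaler0 addr0.
by rewrite Ldown_linear lmul_linear Lup_linear.
Qed.
HB.instance Definition _ j a r :=
  GRing.isLinear.Build Fq (Mt r) (Mt r) _ (@Llow j a r) (@Llow_linear j a r).

Lemma lmul_tens r h h' (I : mi r) : lmul h (tens I h') = tens I (h * h').
Proof. by apply/ffunP => J; rewrite !ffunE; case: eqP; rewrite ?mulr0. Qed.

Lemma fdiag_tens r j (I : mi r) h : fdiag j (tens I h) = (\prod_t fsc j (I t)) *: tens I h.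
Proof. by apply/ffunP => J; rewrite !ffunE; case: eqP => [->|]; rewrite ?scaler0. Qed.

(** The skew Leibniz rule: the defining sum is split according to whether the removed letter is the
    leftmost one or lies in x. *)
Lemma Ldown_Lup r j a (x : Mt r) : Ldown T j (Lup a x) =
  (a == j)%:R *: fdiag j x + sgn (parity j && parity a) *: Llow j a x.
Proof.
apply: (linear_ext_tens (f := fun x => Ldown T j (Lup a x))
  (g := fun x => (a == j)%:R *: fdiag j x + sgn (parity j && parity a) *: Llow j a x)).
- by move=> c u v; rewrite Lup_linear Ldown_linear.
- move=> c u v; rewrite fdiag_linear Llow_linear !scalerDr !scalerA ![_ * c]mulrC -!addrA.
  by congr (_ + _); rewrite addrCA.
move=> I h; rewrite Lup_tens Ldown_tens big_mkcond big_ord_recr /= [LHS]addrC; congr (_ + _).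
  rewrite consI_max; case: eqP => // _; last by rewrite scale0r.
  by rewrite scale1r fdiag_tens rmv_max gprod_max mul1r lcoef_max.
case: r I x => [|r] I x /=; first by rewrite big_ord0 scaler0.
rewrite Ldown_tens [in RHS]big_mkcond !linear_sum; apply: eq_bigr => p _ /=.
rewrite consI_widen; case: eqP => _; last by rewrite !linear0.
rewrite [lmul _ (_ *: _)]linearZ [Lup _ (_ *: _)]linearZ /= lmul_tens Lup_tens.
rewrite rmv_widen gprod_widen lcoef_widen.
by rewrite scalerA -[geps _ _ _ * _ * _]mulrA.
Qed.

End Tensors.

(** * The relations of the tensor product over the Hecke algebra *)

Section Relations.
Variables (m n : nat) (H : falgType Fq) (T : nat -> H).
Local Notation idx := 'I_(m + n).
Local Notation mi r := (MI m n r).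
Local Notation Mt r := (MT m n H r).
Local Notation Rl r := (Rel m n T r).
Implicit Types (a b j : idx) (h : H).

(** The shape of a defining relation for adjacent letters b, a: x stands for the swapped tensor, y
    for the unswapped one, z for the term with T_k moved into H. Keeping them abstract lets linear
    maps be pushed through. *)
Definition rcomb (V : lmodType Fq) b a (x y z : V) : V :=
  (if (b < a)%N then sgn (parity a && parity b) *: x
   else if a == b then (sgn (parity a) * qof a) *: y
   else sgn (parity a && parity b) *: x + xi *: y) - z.

Lemma rcomb_map (V V' : lmodType Fq) (f : V -> V') b a x y z : linear f ->
  f (rcomb b a x y z) = rcomb b a (f x) (f y) (f z).
Proof.
move=> fL; rewrite /rcomb (linear_atB fL); congr (_ - _).
by case: ifP => _; [|case: ifP => _]; rewrite ?fL (linear_atZ fL).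
Qed.

Lemma rcombD (V : lmodType Fq) b a (x y z x' y' z' : V) :
  rcomb b a (x + x') (y + y') (z + z') = rcomb b a x y z + rcomb b a x' y' z'.
Proof.
rewrite /rcomb opprD addrACA; congr (_ + _).
case: ifP => _; first by rewrite scalerDr.
by case: ifP => _; rewrite !scalerDr // addrACA.
Qed.

Lemma rcombZ (V : lmodType Fq) b a c (x y z : V) :
  rcomb b a (c *: x) (c *: y) (c *: z) = c *: rcomb b a x y z.
Proof.
rewrite -(rcomb_map (f := GRing.scale c)) // => e u v.
by rewrite scalerDr !scalerA [c * e]mulrC.
Qed.

(* The relation (e_b e_a y).T_k - e_b e_a (x) T_k y for the two leftmost letters, k = r+1. *)
Definition Rtop r b a (y : Mt r) : Mt r.+2 :=
  rcomb b a (Lup a (Lup b y)) (Lup b (Lup a y)) (Lup b (Lup a (lmul (T r.+1) y))).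

Lemma Rtop_linear r b a : linear (@Rtop r b a).
Proof.
move=> c u v; rewrite /Rtop lmul_linear !Lup_linear rcombD.
by rewrite rcombZ.
Qed.

Lemma nth_codom_ord r (I : mi r) a p (pr : (p < r)%N) : nth a (codom I) p = I (Ordinal pr).
Proof.
rewrite codomE (nth_map (Ordinal pr)) ?size_enum_ord //; congr (I _).
by apply: val_inj; rewrite /= nth_enum_ord.
Qed.

Lemma sum_delta_tens r (K : mi r) (c : Fq) h :
  \sum_(J : mi r) ((J == K)%:R * c) *: tens J h = c *: tens K h.
Proof.
rewrite (bigD1 K) //= eqxx mul1r big1 ?addr0 // => J /negPf ->.
by rewrite mul0r scale0r.
Qed.

Lemma relgenE r (p : 'I_r) (I : mi r) h : relgen T p I h =
  rcomb (nth (I p) (codom I) p.+1) (I p) (tens (swapmi p I) h) (tens I h)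
    (tens I (T p.+1 * h)).
Proof.
rewrite /relgen /rcomb /tcoef; congr (_ - _).
case: ifP => _; first exact: sum_delta_tens.
case: ifP => _; first exact: sum_delta_tens.
by under eq_bigr do rewrite scalerDl; rewrite big_split /= !sum_delta_tens.
Qed.

Lemma swapmi_cons r a (p : 'I_r) (I : mi r) : (p.+1 < r)%N ->
  swapmi p (consI a I) = consI a (swapmi p I).
Proof.
move=> pr; have pr' : (p.+1 < r.+1)%N by apply: ltnW.
have eO : Ordinal pr' = widen_ord (leqnSn r) (Ordinal pr) by apply: val_inj.
apply/ffunP => t; rewrite ffunE !(nth_codom_ord _ _ pr') (nth_codom_ord _ _ (ltnW pr')) eO.
have -> : Ordinal (ltnW pr') = widen_ord (leqnSn r) p by apply: val_inj.
rewrite !consI_widen; case: (ord_topP t) => [|t'] /=.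
  by rewrite !consI_max !gtn_eqF // ltnW.
rewrite !consI_widen ffunE (nth_codom_ord _ _ pr) (nth_codom_ord _ _ (ltn_ord p)).
by do 2!(case: ifP => // _); congr (I _); apply: val_inj.
Qed.

Lemma swapmi_top r a b (I : mi r) : swapmi r (consI b (consI a I)) = consI a (consI b I).
Proof.
have pm : (r.+1 < r.+2)%N by [].
have pm' : (r < r.+2)%N by [].
have eO : Ordinal pm = ord_max by apply: val_inj.
have eO' : Ordinal pm' = widen_ord (leqnSn r.+1) ord_max by apply: val_inj.
apply/ffunP => t; rewrite ffunE !(nth_codom_ord _ _ pm) !(nth_codom_ord _ _ pm').
rewrite eO eO' consI_max consI_widen consI_max.
case: (ord_topP t) => [|t'] /=.
  by rewrite (gtn_eqF (ltnSn r)) eqxx consI_max.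
rewrite !consI_widen; case: (ord_topP t') => [|t''] /=; rewrite ?consI_max ?consI_widen.
  by rewrite eqxx.
by rewrite (ltn_eqF (ltn_ord t'')) (ltn_eqF (leqW (ltn_ord t''))).
Qed.

Lemma relgen_cons r a (p : 'I_r) (I : mi r) h : (p.+1 < r)%N ->
  relgen T (widen_ord (leqnSn r) p) (consI a I) h = Lup a (relgen T p I h).
Proof.
move=> pr; rewrite !relgenE (rcomb_map _ _ _ _ _ (@Lup_linear m n H r a)) !Lup_tens /=.
have pr' : (p.+1 < r.+1)%N by apply: ltnW.
have eO : Ordinal pr' = widen_ord (leqnSn r) (Ordinal pr) by apply: val_inj.
rewrite (nth_codom_ord _ _ pr) (nth_codom_ord _ _ pr') eO !consI_widen.
by rewrite swapmi_cons.
Qed.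

Lemma relgen_top r a b (p : 'I_r.+2) (I : mi r) h : p = r :> nat ->
  relgen T p (consI b (consI a I)) h = Rtop b a (tens I h).
Proof.
move=> pr; have -> : p = widen_ord (leqnSn r.+1) ord_max by apply: val_inj.
rewrite /Rtop relgenE lmul_tens !Lup_tens /= consI_widen consI_max swapmi_top.
have pm : (r.+1 < r.+2)%N by [].
by rewrite (nth_codom_ord _ _ pm) (_ : Ordinal pm = ord_max) ?consI_max //; apply: val_inj.
Qed.

Lemma relgen_linear r (p : 'I_r) I : linear (relgen T p I : H -> Mt r).
Proof.
move=> c u v; rewrite !relgenE mulrDr -scalerAr !tens_linear rcombD.
by rewrite rcombZ.
Qed.

Lemma relgen_in r (p : 'I_r) I h : (p.+1 < r)%N -> relgen T p I h \in Rl r.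
Proof.
move=> pr; rewrite (coord_vbasis (memvf h)) (linear_at_sum (@relgen_linear r p I)).
apply: memv_suml => i _; rewrite (linear_atZ (@relgen_linear r p I)).
apply: memvZ; apply: memv_span.
apply/flattenP; exists [seq relgen T p Ii h | Ii <- enum (mi r), h <- vbasis {: H}].
  by apply/mapP; exists p => //; rewrite mem_filter pr mem_enum.
apply/allpairsP; exists (I, (vbasis {: H})`_i) => /=.
by rewrite mem_enum; split=> //; apply: mem_nth; rewrite size_tuple.
Qed.

Lemma Rel_sub r (V : vectType Fq) (f : Mt r -> V) (U : {vspace V}) : linear f ->
  (forall (p : 'I_r) I h, (p.+1 < r)%N -> f (relgen T p I h) \in U) ->
  forall x, x \in Rl r -> f x \in U.
Proof.
move=> fL hU x.
suff /subvP h : (Rl r <= hom_of fL @^-1: U)%VS by move=> /h; rewrite preim_hom_of.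
apply/span_subvP => _ /flattenP[s /mapP[p + ->] /allpairsP[[I h] [/= _ _ ->]]].
rewrite mem_filter => /andP[pr _]; rewrite preim_hom_of; exact: hU.
Qed.

Lemma Rel_small r x : (r < 2)%N -> x \in Rl r -> x = 0.
Proof.
move=> r2 xR; apply/eqP; rewrite -memv0; apply: (Rel_sub (f := id)) xR => // p I h pr.
by lia.
Qed.

Lemma Rel_Lup r a x : x \in Rl r -> Lup a x \in Rl r.+1.
Proof.
apply: Rel_sub; first exact: Lup_linear.
by move=> p I h pr; rewrite -relgen_cons //; apply: relgen_in; exact: leqW pr.
Qed.

Lemma Rtop_in r b a (y : Mt r) : Rtop b a y \in Rl r.+2.
Proof.
rewrite (tens_expand y) (linear_at_sum (@Rtop_linear r b a)); apply: memv_suml => I _.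
rewrite -(@relgen_top r a b (widen_ord (leqnSn r.+1) ord_max) I (y I) erefl).
exact: relgen_in.
Qed.

(** Induction on the degree rests on this: a generating relation either involves the two leftmost
    letters or is a letter times a relation of lower degree. *)
Lemma Rel_cases r (V : vectType Fq) (f : Mt r.+2 -> V) (U : {vspace V}) : linear f ->
  (forall a z, z \in Rl r.+1 -> f (Lup a z) \in U) ->
  (forall b a y, f (Rtop b a y) \in U) ->
  forall x, x \in Rl r.+2 -> f x \in U.
Proof.
move=> fL h1 h2; apply: Rel_sub => // p I h pr.
case: (ord_topP p) pr => [|p'] /=; first by rewrite ltnn.
rewrite ltnS leq_eqVlt => /orP[/eqP[pE]|pr].
  rewrite [I]consIP; set b := I _; set I' := finfun _; rewrite [I']consIP.
  by rewrite relgen_top //; apply: h2.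
by rewrite [I]consIP relgen_cons //; apply: h1; apply: relgen_in.
Qed.

Lemma Rel_lmul r h x : (forall i, (0 < i < r)%N -> h * T i = T i * h) ->
  x \in Rl r -> lmul h x \in Rl r.
Proof.
move=> hC; apply: Rel_sub; first exact: lmul_linear.
move=> p I h' pr; rewrite relgenE (rcomb_map _ _ _ _ _ (@lmul_linear m n H r h)) !lmul_tens.
by rewrite mulrA hC ?pr // -mulrA -relgenE; apply: relgen_in.
Qed.

Lemma rho_tens r (I : mi r) h s : rho s (tens I h) = tens I (h * s).
Proof. by apply/ffunP => J; rewrite !ffunE; case: eqP; rewrite ?mul0r. Qed.

Lemma Rel_rho r s x : x \in Rl r -> rho s x \in Rl r.
Proof.
apply: Rel_sub; first exact: rho_linear.
move=> p I h' pr; rewrite relgenE (rcomb_map _ _ _ _ _ (@rho_linear m n H r s)) !rho_tens.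
by rewrite -mulrA -relgenE; apply: relgen_in.
Qed.

Lemma fdiag_Lup r j a (x : Mt r) : fdiag j (Lup a x) = fsc j a *: Lup a (fdiag j x).
Proof.
apply/ffunP => J; rewrite [J]consIP; set b := J _; set J' := [ffun _ => _].
rewrite ffunE Lup_cons ffunE Lup_cons big_ord_recr /= consI_max.
case: eqP => [->|_]; last by rewrite !scaler0.
rewrite ffunE scalerA mulrC; congr ((_ * _) *: _).
by apply: eq_bigr => t _; rewrite consI_widen.
Qed.

Lemma fdiag_lmul r j h (x : Mt r) : fdiag j (lmul h x) = lmul h (fdiag j x).
Proof. by apply/ffunP => I; rewrite !ffunE scalerAr. Qed.

(** The eigenvalue of f_j on a tensor does not depend on the order of the letters, so all terms of a
    relation are scaled alike. *)
Lemma Rel_fdiag r j x : x \in Rl r -> fdiag j x \in Rl r.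
Proof.
elim: r x => [|[|r] IHr] x.
- by move=> /Rel_small->; rewrite // linear0 mem0v.
- by move=> /Rel_small->; rewrite // linear0 mem0v.
apply: Rel_cases; first exact: fdiag_linear.
  by move=> a z zR; rewrite fdiag_Lup; apply: memvZ; apply: Rel_Lup; apply: IHr.
move=> b a y; rewrite /Rtop (rcomb_map _ _ _ _ _ (@fdiag_linear m n H r.+2 j)).
rewrite !fdiag_Lup fdiag_lmul ![Lup _ (_ *: _)]linearZ /= !scalerA [fsc j a * _]mulrC.
by rewrite rcombZ; apply: memvZ; apply: Rtop_in.
Qed.

End Relations.

(** * Descent of the annihilation operators to the quotient *)

Section BraidUnits.
Variables (A : unitRingType) (x y : A).
Hypotheses (xU : x \is a GRing.unit) (yU : y \is a GRing.unit) (xyx : x * y * x = y * x * y).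

Lemma braid_conj : y^-1 * x * y = x * y * x^-1.
Proof. by apply: (mulrI yU); apply: (mulIr xU); rewrite !mulrA divrr // mul1r mulrVK // -xyx. Qed.

Lemma braid_conjV : y^-1 * x^-1 * y = x * y^-1 * x^-1.
Proof.
have xVU : x^-1 \is a GRing.unit by rewrite unitrV.
have yVU : y^-1 \is a GRing.unit by rewrite unitrV.
have /= := congr1 (fun z => z^-1) braid_conj.
by rewrite !invrM ?unitrMl // !invrK !mulrA.
Qed.

Lemma braid_conj' : y * x^-1 * y^-1 = x^-1 * y^-1 * x.
Proof.
by apply: (mulrI xU); apply: (mulIr yU); rewrite !mulrA mulrVK // divrr // mul1r braid_conj.
Qed.

End BraidUnits.

Section Descent.
Variables (m n : nat) (H : falgType Fq) (T : nat -> H) (D : nat).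
Hypothesis hT : hecke_rel D T.
Local Notation idx := 'I_(m + n).
Local Notation mi r := (MI m n r).
Local Notation Mt r := (MT m n H r).
Local Notation Rl r := (Rel m n T r).
Implicit Types (a b j : idx) (h : H).

Lemma hecke_mulrB i : (0 < i < D)%N -> T i * (T i - xi%:A) = 1.
Proof.
by move=> hi; rewrite mulrBr (hecke_sqr hT hi) -scalerAr mulr1 addrK.
Qed.

Lemma hecke_unit i : (0 < i < D)%N -> T i \is a GRing.unit.
Proof.
move=> hi; apply/unitrP; exists (T i - xi%:A); split; last exact: hecke_mulrB.
by rewrite mulrBl -scalerAl mul1r (hecke_sqr hT hi) addrK.
Qed.

Lemma heckeV i : (0 < i < D)%N -> (T i)^-1 = T i - xi%:A.
Proof.
move=> hi; apply: (mulrI (hecke_unit hi)).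
by rewrite hecke_mulrB // divrr // hecke_unit.
Qed.

Lemma geps_comm a j i h : h * T i = T i * h -> h * geps T a j i = geps T a j i * h.
Proof. by rewrite /geps; case: ifP => // _; apply: commrV. Qed.

(** Each position of a and b relative to j gives a conjugated form of the braid relation. The second
    branch says [E b * e a * (T r.+1)^-1 = (T r)^-1 * (E a * e b)], written with [xi] so as to match
    the third case of [rcomb]. *)
Lemma braid_eps r b a j (E := fun c : idx => geps T c j r.+1) (e := fun c : idx => geps T c j r) :
  (0 < r)%N -> (r.+1 < D)%N ->
  if (b <= a)%N then E b * e a * T r.+1 = T r * (E a * e b)
  else E b * e a * T r.+1 - xi *: (E b * e a) = T r * (E a * e b) - xi *: (E a * e b).
Proof.
move=> r0 rD.
have tU : T r \is a GRing.unit by apply: hecke_unit; lia.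
have sU : T r.+1 \is a GRing.unit by apply: hecke_unit; lia.
have tst := hecke_braid hT r0 rD.
have sV : (T r.+1)^-1 = T r.+1 - xi%:A by apply: heckeV; lia.
have tV : (T r)^-1 = T r - xi%:A by apply: heckeV; lia.
rewrite /E /e /geps !mulrA; case: (ltnP b j) => bj; case: (ltnP a j) => aj.
- by rewrite braid_conjV //; case: ifP.
- by rewrite braid_conj // (leq_trans (ltnW bj) aj).
- rewrite leqNgt (leq_trans aj bj) /=.
  have -> x : x * T r.+1 - xi *: x = x * (T r.+1)^-1 by rewrite sV mulrBr -scalerAr mulr1.
  have -> : T r * (T r.+1)^-1 * T r - xi *: ((T r.+1)^-1 * T r) = (T r)^-1 * (T r.+1)^-1 * T r.
    by rewrite tV !mulrBl -!scalerAl mul1r.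
  exact: braid_conj'.
- by rewrite tst; case: ifP.
Qed.

Lemma Ldown_lmul r j h (x : Mt r.+1) : (forall i, (0 < i < r.+1)%N -> h * T i = T i * h) ->
  Ldown T j (lmul h x) = lmul h (Ldown T j x).
Proof.
move=> hC; rewrite /Ldown linear_sum; apply: eq_bigr => I _.
rewrite linear_sum; apply: eq_bigr => p _; rewrite linearZ /= lmul_tens ffunE !mulrA.
congr (_ *: tens _ (_ * _)); apply/esym; rewrite /gprod big_seq_cond; apply: commr_prod => t.
move=> /andP[_ pt]; apply: geps_comm; apply: hC; rewrite ltn_ord andbT.
exact: leq_ltn_trans pt.
Qed.

Lemma sgn_sqr (e : bool) : sgn e * sgn e = 1.
Proof. by case: e; rewrite /sgn ?mulrNN mulr1. Qed.

Lemma qofB j : qof j - (qof j)^-1 = sgn (parity j) * xi.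
Proof.
by rewrite /qof; case: (parity j); rewrite /sgn ?invrK ?mul1r // mulN1r opprB.
Qed.

Lemma Ldown_LupLup r j b a (z : Mt r) :
  Ldown T j (Lup b (Lup a z)) =
  ((b == j)%:R *: (fsc j a *: Lup a (fdiag j z))
   + sgn (parity j && parity b) *: ((a == j)%:R *: Lup b (lmul (geps T b j r.+1) (fdiag j z))))
  + sgn (parity j && parity b) *:
    (sgn (parity j && parity a) *: Lup b (lmul (geps T b j r.+1) (Llow T j a z))).
Proof.
rewrite Ldown_Lup fdiag_Lup /= Ldown_Lup -addrA; congr (_ + _).
rewrite lmul_linear Lup_linear scalerDr; congr (_ + _ *: _).
by rewrite [lmul _ (_ *: _)]linearZ [Lup _ (_ *: _)]linearZ.
Qed.

Lemma lmulM r h h' (x : Mt r) : lmul h (lmul h' x) = lmul (h * h') x.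
Proof. by apply/ffunP => I; rewrite !ffunE mulrA. Qed.

Lemma lmul1 r (x : Mt r) : lmul 1 x = x.
Proof. by apply/ffunP => I; rewrite !ffunE mul1r. Qed.

Lemma lmulD r c h h' (x : Mt r) : lmul (c *: h + h') x = c *: lmul h x + lmul h' x.
Proof. by apply/ffunP => I; rewrite !ffunE mulrDl scalerAl. Qed.

Lemma lmul_Lup r h a (x : Mt r) : lmul h (Lup a x) = Lup a (lmul h x).
Proof. by apply/ffunP => J; rewrite !ffunE; case: ifP; rewrite ?mulr0 // ffunE. Qed.

Lemma rcomb0 (V : lmodType Fq) b a : rcomb b a (0 : V) 0 0 = 0.
Proof. by rewrite /rcomb !scaler0 addr0 !if_same subr0. Qed.

Lemma quadratic_cancel (F : fieldType) (V : lmodType F) (c q x : F) (v w : V) :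
  q != 0 -> c * c = 1 -> q - q^-1 = c * x ->
  (c * q) *: (q^-1 *: v + c *: w) - (q^-1 *: w + c *: (x *: w + v)) = 0.
Proof.
move=> q0 cc qx; rewrite !scalerDr !scalerA -qx mulfK // [c * q]mulrC -mulrA cc mulr1.
by rewrite [_ *: w + (_ + _)]addrA -scalerDl [q^-1 + _]addrC subrK [q *: w + _]addrC subrr.
Qed.

Lemma Rtop_strands r j b a (u : Mt r)
    (P := fun (b a : idx) h => (b == j)%:R *: (fsc j a *: Lup a (lmul h u))
       + sgn (parity j && parity b) *: ((a == j)%:R *: Lup b (lmul (geps T b j r.+1 * h) u))) :
  (r.+1 < D)%N -> rcomb b a (P a b 1) (P b a 1) (P b a (T r.+1)) = 0.
Proof.
move=> rD; have hr : (0 < r.+1 < D)%N by lia.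
have SS := hecke_sqr hT hr; rewrite addrC in SS.
have SV := heckeV hr; have SU := hecke_unit hr.
have s2 (v : Mt r.+1) e e' : sgn (e && e') *: (sgn (e' && e) *: v) = v.
  by rewrite scalerA andbC sgn_sqr scale1r.
rewrite /P; case: (eqVneq b j) => [->|bj]; case: (eqVneq a j) => [->|aj].
- rewrite /rcomb ltnn eqxx andbb /fsc eqxx !scale1r /geps ltnn mulr1 SS lmulD Lup_linear lmul1.
  apply: quadratic_cancel; [|exact: sgn_sqr|exact: qofB].
  by rewrite /qof; case: ifP => _; rewrite ?invr_eq0; exact: qq_neq0.
- rewrite !scale0r !scaler0 !add0r !addr0 !scale1r /fsc (negPf aj) !scale1r mulr1 lmul1.
  rewrite /rcomb (negPf aj) /geps; case: ltnP => [ja|]; rewrite ?s2.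
    by rewrite ltnNge ltnW // subrr.
  rewrite leq_eqVlt val_eqE (negPf aj) /= => ->; rewrite SV.
  have -> : T r.+1 - xi%:A = (- xi) *: 1 + T r.+1 by rewrite scaleNr addrC.
  by rewrite lmulD lmul1 Lup_linear scaleNr addrAC addrK addNr.
- rewrite !scale0r !scaler0 !add0r !addr0 !scale1r /fsc (negPf bj) !scale1r mulr1 lmul1.
  rewrite /rcomb eq_sym (negPf bj) /geps; case: ltnP => [bj'|].
    by rewrite mulVr // lmul1 andbC subrr.
  rewrite [parity j && _]andbC SS lmulD lmul1 Lup_linear => _.
  by rewrite scalerDr !scalerA [xi * _]mulrC [_ *: Lup b u + _]addrC subrr.
- by rewrite !scale0r !scaler0 !addr0 rcomb0.
Qed.

(** When the removed letter lies further right, [braid_eps] moves the Hecke factor past the two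
    leftmost strands, and a relation for the same two letters in one degree lower results. *)
Lemma Rtop_rest r j b a (y : Mt r)
    (P := fun (b a : idx) (y : Mt r) => sgn (parity j && parity b) *:
       (sgn (parity j && parity a) *: Lup b (lmul (geps T b j r.+1) (Llow T j a y)))) :
  (r.+1 < D)%N -> rcomb b a (P a b y) (P b a y) (P b a (lmul (T r.+1) y)) \in Rl r.+1.
Proof.
rewrite /P; case: r y {P} => [|r] y rD /=.
  by rewrite !linear0 rcomb0 mem0v.
rewrite Ldown_lmul; last by move=> i hi; apply: (heckeC hT); lia.
set Y := Ldown T j y; rewrite !lmul_Lup !lmulM.
rewrite !scalerA [sgn (_ && parity a) * _]mulrC rcombZ; apply: memvZ.
suff -> z z' z'' : z = geps T a j r.+2 * geps T b j r.+1 ->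
    z' = geps T b j r.+2 * geps T a j r.+1 -> z'' = z' * T r.+2 ->
    rcomb b a (Lup a (Lup b (lmul z Y))) (Lup b (Lup a (lmul z' Y))) (Lup b (Lup a (lmul z'' Y)))
    = Rtop T b a (lmul z Y) by [exact: Rtop_in|].
move=> zE z'E z''E; rewrite /Rtop lmulM.
have /= := @braid_eps r.+1 b a j (ltn0Sn r) rD; rewrite -zE -z'E -z''E {z''E}.
rewrite /rcomb; case: ltngtP => [ba|ab|/val_inj E].
- by move=> ->.
- rewrite -val_eqE ltn_eqF // => e.
  (* The correction [xi *: z'] is absorbed by the unswapped term of the relation for b > a. *)
  have -> : z'' = xi *: z' + (T r.+1 * z - xi *: z) by rewrite -e addrC subrK.
  rewrite -{2}[T r.+1 * z](subrK (xi *: z)) [_ + xi *: z]addrC.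
  rewrite !lmulD !Lup_linear.
  by rewrite !opprD !addrA !addrK.
- by move=> ->; have -> : z' = z by rewrite zE z'E E.
Qed.

Lemma Rel_Ldown r j x : (r < D)%N -> x \in Rl r.+1 -> Ldown T j x \in Rl r.
Proof.
elim: r x => [|r IHr] x rD; first by move=> /Rel_small->; rewrite // linear0 mem0v.
apply: (Rel_cases (f := Ldown T j)); first exact: Ldown_linear.
  move=> a z zR; rewrite Ldown_Lup; apply: memvD; apply: memvZ; first exact: Rel_fdiag.
  apply: Rel_Lup; apply: Rel_lmul => [i hi|]; last by apply: IHr => //; lia.
  by rewrite -geps_comm //; apply: (heckeC hT); lia.
move=> b a y; rewrite /Rtop (rcomb_map _ _ _ _ _ (@Ldown_linear m n H T r.+1 j)).
rewrite !Ldown_LupLup rcombD; apply: memvD; last exact: Rtop_rest.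
have := @Rtop_strands r j b a (fdiag j y) rD; rewrite fdiag_lmul !lmulM !mulr1 !lmul1 => ->.
exact: mem0v.
Qed.

End Descent.

(** * Weights *)

Section Weights.
Variables (m n : nat) (H : falgType Fq) (T : nat -> H) (D : nat).
Hypothesis hT : hecke_rel D T.
Local Notation idx := 'I_(m + n).
Local Notation mi r := (MI m n r).
Local Notation Mt r := (MT m n H r).
Local Notation Rl r := (Rel m n T r).
Local Notation wtT := {ffun idx -> nat}.
Implicit Types (a b j : idx) (h : H) (J : nat -> idx) (kap : wtT).

Lemma LupZ r a c (x : Mt r) : Lup a (c *: x) = c *: Lup a x.
Proof. exact: linearZ. Qed.

Lemma LupBZ r a c (x y : Mt r) : Lup a (x - c *: y) = Lup a x - c *: Lup a y.
Proof. by rewrite -LupZ; exact: linearB. Qed.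

Definition wt r (I : mi r) : wtT := [ffun c => \sum_t (I t == c)]%N.

(** The subtraction is truncated at 0; this does no harm in [wcoef], where an exhausted letter
    already contributes the factor [0] = 0. *)
Definition dec kap j : wtT := [ffun c => kap c - (j == c)]%N.

Lemma wt_cons r a (I : mi r) c : wt (consI a I) c = (wt I c + (a == c))%N.
Proof.
rewrite !ffunE big_ord_recr /= consI_max; congr (_ + _)%N.
by apply: eq_bigr => t _; rewrite consI_widen.
Qed.

Lemma wt_rmv r (I : mi r.+1) p : wt (rmv I p) = dec (wt I) (I p).
Proof.
apply/ffunP => c; rewrite !ffunE (bigD1_ord p) //= addKn.
by apply: eq_bigr => t _; rewrite ffunE.
Qed.

Lemma fdiag_tens_wt r j (I : mi r) h : fdiag j (tens I h) = (qof j ^- wt I j) *: tens I h.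
Proof.
rewrite fdiag_tens ffunE; congr (_ *: _).
rewrite -exprVn -prodrXr; apply: eq_bigr => t _; rewrite /fsc; case: eqP => _.
  by rewrite expr1.
by rewrite expr0.
Qed.

Lemma Lup_same r j (y : Mt r) :
  Lup j (Lup j (lmul (T r.+1) y)) - (sgn (parity j) * qof j) *: Lup j (Lup j y) \in Rl r.+2.
Proof.
have := Rtop_in T j j y; rewrite /Rtop /rcomb ltnn eqxx -memvN.
by rewrite opprB.
Qed.

(** This rearranges the relation for the letters j, a. For a < j the relation carries an extra [xi]
    term, which turns [T r.+1] into its inverse, exactly as in [geps]. *)
Lemma Lup_swap r j a (y : Mt r) : (r.+1 < D)%N -> a != j ->
  sgn (parity j && parity a) *: Lup j (Lup a (lmul (geps T a j r.+1) y)) - Lup a (Lup j y)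
    \in Rl r.+2.
Proof.
move=> rD aj; have hr : (0 < r.+1 < D)%N by lia.
have s2 (v : Mt r.+2) e e' : sgn (e && e') *: (sgn (e' && e) *: v) = v.
  by rewrite scalerA andbC sgn_sqr scale1r.
suff : sgn (parity a && parity j) *: Lup a (Lup j y)
    - Lup j (Lup a (lmul (geps T a j r.+1) y)) \in Rl r.+2.
  move=> h; rewrite -memvN opprB -[X in X - _](s2 _ (parity j) (parity a)) -scalerBr.
  exact: memvZ.
have := Rtop_in T j a y; rewrite /Rtop /rcomb (negPf aj) /geps.
case: ltngtP => [ja|ja|/val_inj E] //; last by rewrite E eqxx in aj.
rewrite (heckeV hT hr).
have -> : T r.+1 - xi%:A = (- xi) *: 1 + T r.+1 by rewrite scaleNr addrC.
by rewrite lmulD lmul1 !Lup_linear scaleNr opprD opprK addrA.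
Qed.

(** Induction by peeling off the leftmost letter a. For a different from j, e_j is exchanged with
    e_a; for a = j, the removed leftmost letter gives q_j^{-w} and the rest gives q_j [w], which add
    up to [w+1]. *)
Lemma euler_tens r j (I : mi r.+1) h : (r < D)%N ->
  Lup j (Ldown T j (tens I h)) - qint (wt I j) *: tens I h \in Rl r.+1.
Proof.
elim: r I => [|r IHr] I rD; rewrite [I]consIP; set a := I _; set I' := finfun _.
  rewrite -Lup_tens Ldown_Lup /= scaler0 addr0 wt_cons fdiag_tens_wt.
  have -> : wt I' j = 0%N by rewrite ffunE big_ord0.
  rewrite expr0 invr1 scale1r; case: eqP => [->|_].
    by rewrite scale1r qint1 scale1r subrr mem0v.
  by rewrite scale0r linear0 qint0 scale0r subrr mem0v.
rewrite -Lup_tens Ldown_Lup /= wt_cons fdiag_tens_wt.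
have {IHr} := IHr I' (ltnW rD); set w := wt I' j; set y := tens I' h; set Y := Ldown T j y.
move=> IH; have := Rel_Lup a IH; rewrite LupBZ => {}IH.
case: eqP IH => [->|/eqP aj] IH.
  rewrite scale1r Lup_linear LupZ andbb addn1 (qintS (parity j)).
  rewrite -/(qof j) scalerDl opprD addrACA subrr add0r.
  rewrite {1}/geps ltnn.
  have e : qof j *: Lup j (Lup j Y)
    = sgn (parity j) *: ((sgn (parity j) * qof j) *: Lup j (Lup j Y)).
    by rewrite scalerA mulrA sgn_sqr mul1r.
  rewrite -(subrK (qof j *: Lup j (Lup j Y)) (sgn _ *: _)) {1}e -scalerBr -addrA.
  apply: memvD; first by apply: memvZ; exact: Lup_same.
  by rewrite -scalerA -scalerBr; apply: memvZ.
rewrite scale0r add0r addn0 LupZ.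
rewrite -(subrK (Lup a (Lup j Y)) (sgn _ *: _)) -addrA.
by apply: memvD => //; apply: Lup_swap.
Qed.

Definition hasw r kap (x : Mt r) := forall I, x I = 0 \/ wt I = kap.

Lemma hasw_tens r (I : mi r) h : hasw (wt I) (tens I h).
Proof. by move=> J; rewrite ffunE; case: eqP => [->|]; [right|left]. Qed.

Lemma euler r j kap (x : Mt r.+1) : (r < D)%N -> hasw kap x ->
  Lup j (Ldown T j x) - qint (kap j) *: x \in Rl r.+1.
Proof.
move=> rD hx; pose f (x : Mt r.+1) := Lup j (Ldown T j x) - qint (kap j) *: x.
have fL : linear f.
  move=> c u v; rewrite /f Ldown_linear Lup_linear scalerDr opprD addrACA scalerBr.
  by rewrite !scalerA [c * _]mulrC.
change (f x \in Rl r.+1); rewrite (tens_expand x) (linear_at_sum fL).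
apply: memv_suml => I _; case: (hx I) => [->|wI]; last by rewrite /f -wI; exact: euler_tens.
by rewrite (linear_at0 (@tens_linear _ _ _ _ I)) (linear_at0 fL) mem0v.
Qed.

Lemma hasw_Ldown r j kap (x : Mt r.+1) : hasw kap x -> hasw (dec kap j) (Ldown T j x).
Proof.
move=> hx I; case: (eqVneq (wt I) (dec kap j)) => [|neq]; first by right.
left; rewrite {1}(tens_expand x) (linear_at_sum (@Ldown_linear _ _ _ T r j)).
rewrite sum_ffunE big1 // => J _.
rewrite Ldown_tens sum_ffunE big1 // => p /eqP pj; rewrite !ffunE.
case: eqP => [IE|_]; last by rewrite scaler0.
case: (hx J) => [->|wJ]; first by rewrite mulr0 scaler0.
by move: neq; rewrite IE wt_rmv pj wJ eqxx.
Qed.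

(** The same coordinate vectors encode the basis vectors e_{J i} and the dual basis vectors. *)
Definition dl J : nat -> {ffun idx -> Fq} := fun i => [ffun c => (c == J i)%:R].

Lemma Lupv_dl r J i (x : Mt r) : Lupv (dl J i) x = Lup (J i) x.
Proof.
rewrite /Lupv (bigD1 (J i)) //= ffunE eqxx scale1r big1 ?addr0 // => a /negPf aJ.
by rewrite ffunE aJ scale0r.
Qed.

Lemma Ldownv_dl r J i (x : Mt r.+1) : Ldownv T (dl J i) x = Ldown T (J i) x.
Proof.
rewrite /Ldownv (bigD1 (J i)) //= ffunE eqxx scale1r big1 ?addr0 // => a /negPf aJ.
by rewrite ffunE aJ scale0r.
Qed.

(** The eigenvalue, modulo relations, on weight [kap] of the operator that removes the first r
    letters of J and puts them back; the weight drops with each removal. *)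
Fixpoint wcoef r J kap : Fq :=
  if r is r'.+1 then qint (kap (J r')) * wcoef r' J (dec kap (J r')) else 1.

Lemma ups_downs r J kap (x : Mt r) : (r <= D)%N -> hasw kap x ->
  ups r (dl J) (downs T (dl J) x) - wcoef r J kap *: x \in Rl r.
Proof.
elim: r kap x => [|r IHr] kap x rD hx; first by rewrite /= scale1r subrr mem0v.
rewrite /= Lupv_dl Ldownv_dl.
have := Rel_Lup (J r) (IHr _ _ (ltnW rD) (hasw_Ldown (J r) hx)).
rewrite LupBZ => h1.
have h2 := memvZ (wcoef r J (dec kap (J r))) (euler (J r) rD hx).
by have := memvD h1 h2; rewrite scalerBr addrA subrK scalerA [_ * qint _]mulrC.
Qed.

Definition wtn r J : wtT := [ffun c => \sum_(i < r) (J i == c)]%N.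

Lemma wtnS r J c : wtn r.+1 J c = (wtn r J c + (J r == c))%N.
Proof. by rewrite !ffunE big_ord_recr. Qed.

Lemma wcoef_neq0 r J : (forall c : nat, (0 < c <= r)%N -> qint c != 0) -> wcoef r J (wtn r J) != 0.
Proof.
elim: r => [|r IHr] hq /=; first exact: oner_neq0.
have -> : dec (wtn r.+1 J) (J r) = wtn r J.
  by apply/ffunP => c; rewrite ffunE wtnS addnK.
have wr : (wtn r.+1 J (J r) <= r.+1)%N.
  rewrite wtnS eqxx addn1 ltnS ffunE.
  rewrite -[X in (_ <= X)%N]card_ord -sum1_card; apply: leq_sum => i _; exact: leq_b1.
have w0 : (0 < wtn r.+1 J (J r))%N by rewrite wtnS eqxx addn1.
have h1 := hq _ (introT andP (conj w0 wr)).
have h2 : wcoef r J (wtn r J) != 0.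
  by apply: IHr => a /andP[a0 ar]; apply: (hq a); rewrite a0 leqW.
exact: (mulf_neq0 h1 h2).
Qed.

(** With equal totals but different multiplicities, some letter of J is exhausted before it is
    removed and yields a factor [0]. *)
Lemma wcoef_eq0 r J kap : (\sum_c kap c = r)%N -> kap != wtn r J -> wcoef r J kap = 0.
Proof.
elim: r kap => [|r IHr] kap kr /=.
  case/eqP; apply/ffunP => c; rewrite ffunE big_ord0.
  by apply/eqP; move/eqP: kr; rewrite sum_nat_eq0 => /forallP /(_ c).
move=> kw; case E : (kap (J r)) => [|w]; first by rewrite qint0 mul0r.
rewrite IHr ?mulr0 //.
  move: kr; rewrite (bigD1 (J r)) //= E addSn => -[kr]; rewrite -[RHS]kr.
  have -> : w = dec kap (J r) (J r) by rewrite ffunE E eqxx subn1.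
  rewrite (bigD1 (J r)) //=; congr (_ + _)%N.
  by apply: eq_bigr => c; rewrite ffunE eq_sym => /negPf ->; rewrite subn0.
apply: contra_neq kw => h; apply/ffunP => c; rewrite wtnS -h ffunE.
by case: eqP => [<-|_]; rewrite ?E ?subn1 ?addn1 // subn0 addn0.
Qed.

Lemma sum_wt r (I : mi r) : (\sum_c wt I c = r)%N.
Proof.
under eq_bigr do rewrite ffunE.
rewrite exchange_big /= -[RHS]card_ord -sum1_card; apply: eq_bigr => t _.
by rewrite (bigD1 (I t)) //= eqxx big1 // => c /negPf; rewrite eq_sym => ->.
Qed.

Definition seqI r J : mi r := [ffun t : 'I_r => J t].

Lemma wt_seqI r J : wt (seqI r J) = wtn r J.
Proof. by apply/ffunP => c; rewrite !ffunE; apply: eq_bigr => t _; rewrite ffunE. Qed.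

Lemma ups_tens r J (I0 : mi 0) h : ups r (dl J) (tens I0 h) = tens (seqI r J) h.
Proof.
elim: r => [|r IHr] /=.
  by congr (tens _ _); apply/ffunP => -[].
rewrite Lupv_dl IHr Lup_tens; congr (tens _ _); apply/ffunP => t.
by case: (ord_topP t) => [|t']; rewrite ?consI_max ?consI_widen !ffunE.
Qed.

Lemma Lupv_linear r v : linear (@Lupv m n H r v).
Proof.
move=> c x y; rewrite /Lupv scaler_sumr -big_split; apply: eq_bigr => a _ /=.
by rewrite Lup_linear scalerDr !scalerA [v a * c]mulrC.
Qed.

Lemma Ldownv_linear r v : linear (@Ldownv m n H T r v).
Proof.
move=> c x y; rewrite /Ldownv scaler_sumr -big_split; apply: eq_bigr => a _ /=.
by rewrite Ldown_linear scalerDr !scalerA [v a * c]mulrC.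
Qed.

Lemma ups_linear r ws : linear (@ups m n H r ws).
Proof. by elim: r => [|r IHr] c x y //=; rewrite IHr Lupv_linear. Qed.

Lemma downs_linear r vs : linear (@downs m n H T r vs).
Proof. by elim: r => [|r IHr] c x y //=; rewrite Ldownv_linear IHr. Qed.

Lemma Lsig_linear s : linear (@Lsig m n H s).
Proof. by move=> c x y; apply/ffunP => I; rewrite !ffunE mulrDr scalerAr. Qed.

(** Annihilation operators preserve relations, and degree 0 has none besides zero. *)
Lemma Rel_downs r vs x : (r <= D)%N -> x \in Rl r -> downs T vs x = 0 :> Mt 0.
Proof.
elim: r x => [|r IHr] x rD xR /=; first exact: Rel_small xR.
apply: IHr (ltnW rD) _; apply: memv_suml => j _; apply: memvZ.
exact: (Rel_Ldown hT).
Qed.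

Lemma Aop_Rel d ws s vs x : (d <= D)%N -> x \in Rl d -> Aop T ws s vs x = 0 :> Mt d.
Proof.
move=> dD xR; rewrite /Aop (Rel_downs _ dD xR) (linear_at0 (@Lsig_linear s)).
exact: (linear_at0 (@ups_linear d ws)).
Qed.

Lemma rho_Lup r a s (x : Mt r) : rho s (Lup a x) = Lup a (rho s x).
Proof. by apply/ffunP => I; rewrite !ffunE; case: ifP; rewrite ?mul0r // ffunE. Qed.

Lemma rho_Ldown r j s (x : Mt r.+1) : rho s (Ldown T j x) = Ldown T j (rho s x).
Proof.
rewrite /Ldown linear_sum; apply: eq_bigr => I _.
rewrite linear_sum; apply: eq_bigr => p _.
by rewrite linearZ /= rho_tens ffunE mulrA.
Qed.

Lemma rho_Aop d ws s vs s' x : rho s' (Aop T ws s vs x) = Aop T ws s vs (rho s' x) :> Mt d.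
Proof.
have hu r (y : Mt 0) : rho s' (ups r ws y) = ups r ws (rho s' y) :> Mt r.
  elim: r => //= r <-; rewrite /Lupv linear_sum; apply: eq_bigr => a _.
  by rewrite linearZ /= rho_Lup.
have hd r (y : Mt r) : rho s' (downs T vs y) = downs T vs (rho s' y).
  elim: r y => //= r IHr y; rewrite IHr; congr (downs _ _ _).
  rewrite /Ldownv linear_sum; apply: eq_bigr => a _.
  by rewrite linearZ /= rho_Ldown.
rewrite /Aop hu -hd; congr (ups _ _ _); apply/ffunP => I; rewrite !ffunE mulrA; congr (_ * _ * _).
Qed.

End Weights.

(** * The double centralizer property *)

Section DoubleCentralizer.
Variables (m n : nat) (H : falgType Fq) (T : nat -> H) (D d : nat).
Hypotheses (hT : hecke_rel D T) (dD : (d <= D)%N) (qd : qfact d != 0) (m0 : (0 < m)%N).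
Hypothesis hgen : forall U : {vspace H}, 1 \in U ->
  (forall i u, (0 < i < D)%N -> u \in U -> T i * u \in U) -> U = fullv.
Local Notation idx := 'I_(m + n).
Local Notation mi := (MI m n d).
Local Notation Mt := (MT m n H d).
Local Notation R := (Rel m n T d).

Lemma rhoM a b (x : Mt) : rho a (rho b x) = rho (b * a) x.
Proof. by apply/ffunP => I; rewrite !ffunE mulrA. Qed.

Lemma rho1 (x : Mt) : rho 1 x = x.
Proof. by apply/ffunP => I; rewrite !ffunE mulr1. Qed.

Lemma rho_linearl (x : Mt) : linear (fun h => rho h x : Mt).
Proof. by move=> c a b; apply/ffunP => I; rewrite !ffunE mulrDr scalerAr. Qed.

Lemma idx_gt0 : (0 < m + n)%N. Proof. by rewrite ltn_addr. Qed.

(** A multi-index extended to all of nat by a default letter; the operators of degree d read only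
    positions below d. *)
Definition letters (I : mi) : nat -> idx := nth (Ordinal idx_gt0) (codom I).

Lemma seqI_letters I : seqI d (letters I) = I.
Proof.
apply/ffunP => t; rewrite ffunE /letters (nth_codom_ord _ _ (ltn_ord t)).
by congr (I _); apply: val_inj.
Qed.

Lemma wtn_letters I : wtn d (letters I) = wt I.
Proof. by rewrite -wt_seqI seqI_letters. Qed.

Definition wrep (kap : {ffun idx -> nat}) := [pick I : mi | wt I == kap].
Definition is_wrep (I : mi) := wrep (wt I) == Some I.

(** Dividing by the eigenvalue yields, modulo relations, the projection onto the weight space of
    [wt I]. *)
Definition wproj (I : mi) (x : Mt) : Mt :=
  (wcoef d (letters I) (wt I))^-1 *: ups d (dl (letters I)) (downs T (dl (letters I)) x).

Lemma wproj_linear I : linear (wproj I).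
Proof.
move=> c x y; rewrite /wproj downs_linear ups_linear scalerDr !scalerA.
by rewrite [_ * c]mulrC.
Qed.

Lemma wproj_tens I J h : wproj I (tens J h) - (if wt I == wt J then tens J h else 0) \in R.
Proof.
have := ups_downs hT (letters I) dD (hasw_tens J h).
rewrite /wproj; set u := ups _ _ _; set c := (wcoef _ _ (wt I))^-1.
case: eqP => [E|/eqP E] hu.
  have c0 : wcoef d (letters I) (wt I) != 0.
    by rewrite -wtn_letters; apply: wcoef_neq0 => a; apply: qint_neq0.
  have := memvZ c hu; rewrite scalerBr scalerA -E /c (mulVf c0).
  by rewrite scale1r.
rewrite subr0; apply: memvZ; move: hu; rewrite wcoef_eq0 ?sum_wt //.
  by rewrite scale0r subr0.
by rewrite wtn_letters eq_sym.
Qed.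

(** With one representative multi-index per weight, the weight projections resolve the identity of
    W. *)
Lemma wproj_sum x : (\sum_(I | is_wrep I) wproj I x) - x \in R.
Proof.
pose f (x : Mt) := (\sum_(I | is_wrep I) wproj I x) - x.
have fL : linear f.
  move=> c u v; rewrite /f scalerBr scaler_sumr opprD addrACA -big_split; congr (_ + _).
  by apply: eq_bigr => I _; rewrite wproj_linear.
change (f x \in R); rewrite (tens_expand x) (linear_at_sum fL).
apply: memv_suml => J _; rewrite /f; set y := tens J _.
have [I0 hI0 wI0] : exists2 I0, wrep (wt J) = Some I0 & wt I0 = wt J.
  rewrite /wrep; case: pickP => [I0 /eqP wI0|/(_ J)]; last by rewrite eqxx.
  by exists I0.
rewrite (bigD1 I0) /=; last by rewrite /is_wrep wI0 hI0.
rewrite addrAC; apply: memvD.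
  by have := wproj_tens I0 J (x J); rewrite wI0 eqxx.
apply: memv_suml => I /andP[/eqP hI II0].
have := wproj_tens I J (x J); case: eqP => [E|_]; last by rewrite subr0.
by move: hI II0; rewrite E hI0 => -[->]; rewrite eqxx.
Qed.

Lemma inA_sum (X : finType) (c : X -> Fq) (ws vs : X -> nat -> {ffun idx -> Fq}) (s : X -> H) :
  inA T (fun x : Mt => \sum_(i : X) c i *: Aop T (ws i) (s i) (vs i) x).
Proof.
exists #|X|, (c \o enum_val), (ws \o enum_val), (vs \o enum_val), (s \o enum_val) => x.
rewrite (reindex (@enum_val X predT)) //=; apply: onW_bij; exact: enum_val_bij.
Qed.

Lemma commutant_inA (f : Mt -> Mt) : lin_op f -> descends R f ->
  (forall s x, f (rho s x) - rho s (f x) \in R) -> exists2 g, inA T g & eqW R f g.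
Proof.
move=> fL fR fC.
(* Each projection factors through degree 0, which is H, as x goes to y and then to e_J y. Thus f
   sends it to f(e_J) y, and the coordinates of f(e_J) serve as the elements sigma. *)
pose c J := if is_wrep J then (wcoef d (letters J) (wt J))^-1 else 0.
exists (fun x : Mt => \sum_(p : mi * mi) c p.1 *:
   Aop T (dl (letters p.2)) (f (tens p.1 1) p.2) (dl (letters p.1)) x).
  exact: inA_sum.
move=> x; have fB u v : f u - f v = f (u - v) by rewrite (linear_atB fL).
rewrite -[f x](subrK (f (\sum_(I | is_wrep I) wproj I x))) fB -addrA.
apply: memvD; first by apply: fR; rewrite -memvN opprB; apply: wproj_sum.
rewrite (linear_at_sum fL) -(pair_bigA _ (fun J I => c J *: Aop T (dl (letters I))
  (f (tens J 1) I) (dl (letters J)) x)) /= big_mkcond -sumrB.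
apply: memv_suml => J _; rewrite /c; case: ifP => hJ; last first.
  by rewrite big1 ?subrr ?mem0v // => I _; rewrite scale0r.
rewrite -scaler_sumr (linear_atZ fL) -scalerBr; apply: memvZ.
pose I0 : MI m n 0 := [ffun t => Ordinal idx_gt0].
pose y := downs T (dl (letters J)) x.
have yE : y = tens I0 (y I0).
  apply/ffunP => I; rewrite ffunE; case: eqP => [->//|]; case.
  by apply/ffunP => -[].
have -> : ups d (dl (letters J)) (downs T (dl (letters J)) x) = rho (y I0) (tens J 1).
  by rewrite -/y yE ups_tens seqI_letters rho_tens mul1r ffunE eqxx.
have -> : \sum_I Aop T (dl (letters I)) (f (tens J 1) I) (dl (letters J)) x
   = rho (y I0) (f (tens J 1)).
  rewrite [in RHS](tens_expand (f (tens J 1)))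
    (linear_at_sum (@rho_linear m n H d (y I0))); apply: eq_bigr => I _.
  rewrite /Aop -/y yE rho_tens.
  have -> : Lsig (f (tens J 1) I) (tens I0 (y I0)) = tens I0 (f (tens J 1) I * y I0).
    by apply/ffunP => K; rewrite !ffunE; case: eqP; rewrite ?mulr0.
  by rewrite ups_tens seqI_letters ffunE eqxx.
exact: fC.
Qed.

(** * Endomorphisms commuting with the first commutant *)

Lemma vanish_gen (V : vectType Fq) (K : H -> V) : linear K -> K 1 = 0 ->
  (forall i u, (0 < i < D)%N -> K u = 0 -> K (T i * u) = 0) -> forall s, K s = 0.
Proof.
move=> KL K1 KT s; apply/eqP; rewrite -(lker_hom_of KL) (hgen (U := lker (hom_of KL))) ?memvf //.
  by rewrite lker_hom_of; apply/eqP.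
by move=> i u hi; rewrite !lker_hom_of => /eqP Ku; apply/eqP; apply: KT.
Qed.

Lemma commute_gen (f : Mt -> Mt) : lin_op f ->
  (forall i x, (0 < i < D)%N -> f (rho (T i) x) = rho (T i) (f x)) ->
  forall s x, f (rho s x) = rho s (f x).
Proof.
move=> fL fT.
(* The commutator is taken as a linear map in s with values in endomorphisms, so that commuting with
   s on every x is a single vanishing condition. *)
pose K s := (hom_of fL \o hom_of (@rho_linear m n H d s))%VF
            - (hom_of (@rho_linear m n H d s) \o hom_of fL)%VF.
have KE s x : K s x = f (rho s x) - rho s (f x).
  by rewrite /K add_lfunE opp_lfunE !comp_lfunE !hom_ofE.
have K0 s : (K s = 0) <-> (forall x, f (rho s x) = rho s (f x)).
  split=> [e x|e]; first by apply/eqP; rewrite -subr_eq0 -KE e zero_lfunE.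
  by apply/lfunP => x; rewrite KE e subrr zero_lfunE.
move=> s; apply/K0; apply: vanish_gen s.
- move=> c a b; apply/lfunP => x; rewrite KE [RHS]add_lfunE scale_lfunE !KE.
  rewrite (rho_linearl x c a b) (rho_linearl (f x) c a b) fL opprD addrACA.
  by rewrite scalerBr.
- by apply/K0 => x; rewrite !rho1.
by move=> i u hi /K0 hu; apply/K0 => x; rewrite -!rhoM hu fT.
Qed.

Lemma casz_central s : casz T D.-1 * s = s * casz T D.-1.
Proof.
apply/eqP; rewrite -subr_eq0; apply/eqP; move: s; apply: vanish_gen.
- by move=> c a b; rewrite mulrDr mulrDl -scalerAr -scalerAl opprD addrACA scalerBr.
- by rewrite mulr1 mul1r subrr.
move=> i u hi /eqP; rewrite subr_eq0 => /eqP hu; apply/eqP; rewrite subr_eq0; apply/eqP.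
rewrite -mulrA -hu !mulrA; congr (_ * _).
rewrite /casz mulr_suml mulr_sumr.
under eq_bigr do rewrite -mulrA.
under [RHS]eq_bigr do rewrite mulrA.
apply/esym; apply: (casimir hT (f := fun a b => a * b : H)); [|lia|lia].
by split=> [y c a b|y c a b]; rewrite ?mulrDl ?mulrDr -?scalerAl -?scalerAr.
Qed.

Lemma memv_subC (U : {vspace Mt}) (u v : Mt) : u - v \in U -> v - u \in U.
Proof. by rewrite -memvN opprB. Qed.

Lemma memv_sub_trans (U : {vspace Mt}) (u v w : Mt) : u - v \in U -> v - w \in U -> u - w \in U.
Proof. by move=> h1 h2; have := memvD h1 h2; rewrite addrA subrK. Qed.

(** A linear map with kernel exactly R, which serves as the quotient map onto W. *)
Definition relpr : 'End(Mt) := \1%VF - projv R.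

Lemma relpr_eq0 x : (relpr x == 0) = (x \in R).
Proof.
rewrite /relpr add_lfunE opp_lfunE id_lfunE subr_eq0; apply/eqP/idP => [->|xR].
  exact: memv_proj.
by rewrite projv_id.
Qed.

Definition ract (h : H) : 'End(Mt) := (relpr \o hom_of (@rho_linear m n H d h))%VF.

Lemma ractE h x : ract h x = relpr (rho h x).
Proof. by rewrite /ract comp_lfunE (hom_ofE (@rho_linear m n H d h)). Qed.

Lemma ract_linear : linear ract.
Proof.
move=> c a b; apply/lfunP => x; rewrite [RHS]add_lfunE scale_lfunE !ractE.
by rewrite rho_linearl linearP.
Qed.

(** A generalized inverse of the action map: it recovers an element of H only up to those acting as
    zero on W, which suffices for its action on W. *)
Definition ract_lift : 'Hom('End(Mt), H) := (hom_of ract_linear)^-1%VF.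

Lemma ract_liftE h w : rho (ract_lift (ract h)) w - rho h w \in R.
Proof.
have e : ract (ract_lift (ract h)) = ract h := hom_of_section ract_linear h.
by rewrite -relpr_eq0 linearB subr_eq0 /= -!ractE e.
Qed.

Local Notation B := (vbasis {:Mt}).

Lemma rank1_linear i x : linear (fun y => coord B i y *: relpr x).
Proof. by move=> c u v; rewrite linearP scalerDl scalerA. Qed.

Definition unitmap i (x : Mt) : 'End(Mt) := hom_of (rank1_linear i x).

Lemma unitmapE i x y : unitmap i x y = coord B i y *: relpr x.
Proof. exact: hom_ofE. Qed.

Lemma unitmap_linear i : linear (unitmap i).
Proof.
move=> c u v; apply/lfunP => y; rewrite [RHS]add_lfunE scale_lfunE !unitmapE linearP.
by rewrite scalerDr !scalerA mulrC.
Qed.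

Lemma sum_unitmap h : \sum_i unitmap i (rho h B`_i) = ract h.
Proof.
apply/lfunP => y; rewrite sum_lfunE ractE {2}(coord_vbasis (memvf y)).
rewrite (linear_at_sum (@rho_linear m n H d h)) linear_sum; apply: eq_bigr => i _.
by rewrite unitmapE (linear_atZ (@rho_linear m n H d h)) linearZ.
Qed.

(* The Casimir average of x |-> w . ract_lift (unitmap i x) commutes with H. *)
Definition average w i (x : Mt) : Mt :=
  \sum_(g <- cas T D.-1) rho (ract_lift (unitmap i (rho g.1 x)) * g.2) w.

Lemma average_linear w i : linear (average w i).
Proof.
move=> c u v; rewrite /average scaler_sumr -big_split; apply: eq_bigr => g _ /=.
by rewrite rho_linear unitmap_linear linearP mulrDl -scalerAl rho_linearl.
Qed.

Lemma average_Rel w i : descends R (average w i).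
Proof.
move=> x xR; apply: memv_suml => g _.
have -> : unitmap i (rho g.1 x) = 0.
  apply/lfunP => y; rewrite unitmapE zero_lfunE; apply/eqP; rewrite scaler_eq0 relpr_eq0.
  by rewrite Rel_rho ?orbT.
by rewrite linear0 mul0r (linear_at0 (rho_linearl w)) mem0v.
Qed.

Lemma average_rho w i s x : average w i (rho s x) = rho s (average w i x).
Proof.
apply: commute_gen s x; first exact: average_linear.
move=> t x ht; rewrite /average (linear_at_sum (@rho_linear m n H d (T t))).
under eq_bigr do rewrite rhoM.
under [RHS]eq_bigr do rewrite rhoM -mulrA.
apply: (casimir hT (f := fun a b => rho (ract_lift (unitmap i (rho a x)) * b) w)); [|lia|lia].
split=> [y c a b|y c a b] /=.
  by rewrite (rho_linearl x c a b) unitmap_linear linearP mulrDl -scalerAl rho_linearl.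
by rewrite mulrDr -scalerAr rho_linearl.
Qed.

(** Summed over the basis, the rank-one maps add up to the action of [g.1], which [ract_lift] turns
    back into an element acting as [g.1]; the sum of the products [g.1 * g.2] is z. *)
Lemma sum_average w : \sum_i average w i B`_i - rho (casz T D.-1) w \in R.
Proof.
have -> : rho (casz T D.-1) w = \sum_(g <- cas T D.-1) rho (g.1 * g.2) w.
  by rewrite /casz (linear_at_sum (rho_linearl w)).
rewrite exchange_big /= -sumrB; apply: memv_suml => g _.
have -> : \sum_i rho (ract_lift (unitmap i (rho g.1 B`_i)) * g.2) w =
    rho g.2 (rho (ract_lift (ract g.1)) w).
  rewrite -sum_unitmap linear_sum rhoM mulr_suml /=.
  by rewrite -(linear_at_sum (rho_linearl w)).
rewrite -rhoM -linearB; apply: Rel_rho; exact: ract_liftE.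
Qed.

Lemma double_commutant (f : Mt -> Mt) : (0 < D)%N -> lin_op f -> descends R f ->
  (forall g, inA T g -> forall x, f (g x) - g (f x) \in R) ->
  exists s : H, eqW R f (rho s).
Proof.
move=> D0 fL fR fA.
have fB u v : f u - f v = f (u - v) by rewrite (linear_atB fL).
(* By the first equality, f commutes with every H-endomorphism of W. *)
have fE t : lin_op t -> descends R t -> (forall s x, t (rho s x) - rho s (t x) \in R) ->
    forall x, f (t x) - t (f x) \in R.
  move=> tL tR tC x; have [g gA tg] := commutant_inA tL tR tC.
  apply: (memv_sub_trans (v := f (g x))); first by rewrite fB; apply: fR; apply: tg.
  apply: (memv_sub_trans (v := g (f x))); first exact: fA.
  by apply: memv_subC; apply: tg.
have [c zc] : exists c, casz T D.-1 * c = 1 by apply: (casz_unit hT); lia.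
pose s := \sum_i \sum_(g <- cas T D.-1) ract_lift (unitmap i (rho g.1 (f B`_i))) * g.2.
(* Since z is central, acting by z is an H-endomorphism, so f(w) z = f(w z). Writing w z as a sum of
   averages at basis vectors and moving f inside them gives w s. *)
have key w : rho (casz T D.-1) (f w) - rho s w \in R.
  apply: (memv_sub_trans (v := f (rho (casz T D.-1) w))).
    apply: memv_subC; apply: (fE (rho (casz T D.-1))).
    - exact: rho_linear.
    - by move=> x; apply: Rel_rho.
    - by move=> u x; rewrite !rhoM casz_central subrr mem0v.
  apply: (memv_sub_trans (v := f (\sum_i average w i B`_i))).
    by rewrite fB; apply: fR; apply: memv_subC; apply: sum_average.
  rewrite (linear_at_sum fL) /s (linear_at_sum (rho_linearl w)) -sumrB.
  apply: memv_suml => i _; rewrite (linear_at_sum (rho_linearl w)).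
  apply: (fE (average w i)); first exact: average_linear.
    exact: average_Rel.
  by move=> u x; rewrite average_rho subrr mem0v.
exists (s * c) => w.
have := Rel_rho c (key w); rewrite linearB /= !rhoM zc rho1.
by [].
Qed.

End DoubleCentralizer.

Theorem theorem7p2 (m n : nat) (H : falgType Fq) (T : nat -> H) (d k : nat) :
  (0 < m)%N -> (0 < n)%N -> (1 <= d)%N -> (k <= d)%N -> qfact d != 0 ->
  hecke_presentation (d + k) T ->
  [/\ (* A_d^k consists of well-defined operators on W commuting with H_{d+k} *)
      (forall f : MT m n H d -> MT m n H d, inA T f ->
         descends (Rel m n T d) f /\
         forall (s : H) x, f (rho s x) - rho s (f x) \in Rel m n T d),
      (* every H_{d+k}-endomorphism of W lies in A_d^k *)
      (forall f : MT m n H d -> MT m n H d, lin_op f -> descends (Rel m n T d) f ->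
         (forall (s : H) x, f (rho s x) - rho s (f x) \in Rel m n T d) ->
         exists2 g, inA T g & eqW (Rel m n T d) f g),
      (* H_{d+k} acts on W and commutes with A_d^k *)
      (forall s : H, descends (Rel m n T d) (@rho m n H d s) /\
         forall g, inA T g -> forall x, rho s (g x) - g (rho s x) \in Rel m n T d)
    & (* every A_d^k-endomorphism of W is (right multiplication by) an element of H_{d+k} *)
      (forall f : MT m n H d -> MT m n H d, lin_op f -> descends (Rel m n T d) f ->
         (forall g, inA T g -> forall x, f (g x) - g (f x) \in Rel m n T d) ->
         exists s : H, eqW (Rel m n T d) f (rho s))].
Proof.
move=> m0 _ d1 _ qd [hT hgen _].
have dD : (d <= d + k)%N by exact: leq_addr.
(* Left and right multiplications commute already on representatives, before passing to the
   quotient. *)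
have rhoA f : inA T f -> forall (s : H) (x : MT m n H d), rho s (f x) = f (rho s x).
  move=> [l [c [ws [vs [t fE]]]]] s x; rewrite !fE (linear_at_sum (@rho_linear m n H d s)).
  by apply: eq_bigr => i _; rewrite (linear_atZ (@rho_linear m n H d s)) rho_Aop.
split.
- move=> f fA; split=> [x xR|s x]; last by rewrite rhoA // subrr mem0v.
  case: fA => [l [c [ws [vs [t ->]]]]]; apply: memv_suml => i _.
  by rewrite (Aop_Rel hT _ _ _ dD xR) scaler0 mem0v.
- exact: (commutant_inA hT dD qd m0).
- move=> s; split=> [x|g gA x]; first exact: Rel_rho.
  by rewrite rhoA // subrr mem0v.
- by move=> f; apply: (double_commutant hT dD qd m0 hgen); lia.
Qed.
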